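(* The class of maximal 3-chops of 3-connected graphs endorses 4-tangles. That is: let $G$ be a 3-connected graph, let $\tau$ be a non-cubic 4-tangle in $G$, and let $N_1,N_2$ be maximal 3-chops of $G$; for $i=1,2$ let $\sigma_i$ be the splitting star of $N_i$ with $\sigma_i\subseteq\tau$. Then the torsos of $\sigma_1$ and $\sigma_2$ are internally 4-connected and isomorphic to each other.
   Context: All graphs are finite and simple. A separation of $G$ is an unordered pair $\{A,B\}$ with $A\cup B=V(G)$ and no edge between $A\setminus B$ and $B\setminus A$; its order is $|A\cap B|$; a 3-separation has order exactly 3; it is proper if $A\setminus B\ne\emptyset\ne B\setminus A$. For oriented separations, $(A,B)\le(C,D)$ iff $A\subseteq C$ and $B\supseteq D$. Two separations are nested if some orientations are $\le$-comparable. A star is a set $\sigma$ of oriented separations with $(A,B)\le(D,C)$ for distinct $(A,B),(C,D)\in\sigma$; bag $\bigcap_{(A,B)\in\sigma}B$ ($V(G)$ if empty); torso: subgraph induced on the bag with each $A\cap B$, $(A,B)\in\sigma$, made into a clique. A splitting star of a set $S$ of separations is a star of orientations of elements of $S$ such that every $\{C,D\}\in S$ has an orientation $\le$ some element of the star. A proper 3-separation $\{A,B\}$ is claw-free if both $G[A]$ and $G[B]$ contain a cycle. A set of proper 3-separations is claw-freeable if it can be enumerated $s_0,\dots,s_n$ so that each $s_i$ is claw-free or shares at least two separator vertices with some $s_j$, $j<i$. A 3-chop is a claw-freeable nested set of proper 3-separations; maximal means not properly contained in another 3-chop of $G$. A $k$-tangle is a set $\tau$ of oriented separations of order $<k$ containing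 exactly one orientation of each separation of order $<k$ and containing no three $(A_i,B_i)$ with $G[A_1]\cup G[A_2]\cup G[A_3]=G$. A set $X$ of four vertices is cubic in $G$ if the set of neighbourhoods of the components of $G-X$ is exactly the set of 3-element subsets of $X$. A 4-tangle $\tau$ in a 3-connected graph is cubic if it contains a star of 3-separations whose bag is a cubic vertex set in $G$; otherwise it is non-cubic. Internally 4-connected: 3-connected, more than four vertices, and every proper 3-separation $\{A,B\}$ has independent separator and $|A\setminus B|=1$ or $|B\setminus A|=1$. *)

(* Defs.v *)
(* Graphs: finite simple graphs given by a finType T of
   vertices and an edge relation e : rel T (assumed symmetric, irreflexive). *)
From mathcomp Require Import all_boot.
Set Implicit Arguments. Unset Strict Implicit. Unset Printing Implicit Defensive.

Notation osep T := ({set T} * {set T})%type.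

Section Graphs.
Variables (T : finType) (e : rel T).

Definition flip (s : osep T) : osep T := (s.2, s.1).

Definition sle (s t : osep T) : bool := (s.1 \subset t.1) && (t.2 \subset s.2).

Definition separation (s : osep T) : Prop :=
  s.1 :|: s.2 = setT /\
  forall x y, x \in s.1 :\: s.2 -> y \in s.2 :\: s.1 -> ~~ e x y.

Definition separator (s : osep T) : {set T} := s.1 :&: s.2.
Definition sorder (s : osep T) : nat := #|separator s|.

Definition proper_sep (s : osep T) : Prop :=
  separation s /\ s.1 :\: s.2 != set0 /\ s.2 :\: s.1 != set0.

Definition proper3 (s : osep T) : Prop := proper_sep s /\ sorder s = 3.

Definition rel_minus (X : {set T}) : rel T :=
  [rel x y | [&& e x y, x \notin X & y \notin X]].

Definition k_connected (k : nat) : Prop :=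
  k < #|T| /\
  forall X : {set T}, #|X| < k ->
    forall x y, x \notin X -> y \notin X -> connect (rel_minus X) x y.

Definition has_cycle (X : {set T}) : Prop :=
  exists s : seq T, [/\ uniq s, 3 <= size s, all (fun v => v \in X) s & cycle e s].

Definition claw_free (s : osep T) : Prop :=
  proper3 s /\ has_cycle s.1 /\ has_cycle s.2.

(* A set of (unordered) separations is represented by the set of all
   orientations of its elements, i.e. a flip-closed set of oriented pairs. *)
Definition sym_set (S : {set osep T}) : Prop := forall s, s \in S -> flip s \in S.

Definition claw_freeable (S : {set osep T}) : Prop :=
  exists l : seq (osep T),
    [/\ forall s, s \in S -> (s \in l) || (flip s \in l),
        forall s, s \in l -> s \in S &
        forall i, i < size l ->
          claw_free (nth (setT, setT) l i) \/
          exists j, j < i /\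
            2 <= #|separator (nth (setT, setT) l i) :&: separator (nth (setT, setT) l j)|].

Definition nested_set (S : {set osep T}) : Prop :=
  forall s t, s \in S -> t \in S ->
    [|| sle s t, sle s (flip t), sle (flip s) t | sle (flip s) (flip t)].

Definition chop3 (S : {set osep T}) : Prop :=
  [/\ sym_set S, forall s, s \in S -> proper3 s, nested_set S & claw_freeable S].

Definition max_chop3 (S : {set osep T}) : Prop :=
  chop3 S /\ ~ exists S' : {set osep T}, chop3 S' /\ S \proper S'.

Definition star (sigma : {set osep T}) : Prop :=
  forall s t, s \in sigma -> t \in sigma -> s != t -> sle s (flip t).

Definition bag (sigma : {set osep T}) : {set T} := \bigcap_(s in sigma) s.2.

Definition splitting_star (S sigma : {set osep T}) : Prop :=
  [/\ sigma \subset S, star sigma &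
      forall s, s \in S -> exists2 t, t \in sigma & sle s t || sle (flip s) t].

Definition covers3 (A1 A2 A3 : {set T}) : Prop :=
  (forall v, [|| v \in A1, v \in A2 | v \in A3]) /\
  (forall x y, e x y ->
     [|| (x \in A1) && (y \in A1), (x \in A2) && (y \in A2) | (x \in A3) && (y \in A3)]).

Definition tangle (k : nat) (tau : {set osep T}) : Prop :=
  [/\ forall s, s \in tau -> separation s /\ sorder s < k,
      forall s, separation s -> sorder s < k ->
        ((s \in tau) || (flip s \in tau)) /\
        ((s \in tau) && (flip s \in tau) -> s.1 = s.2) &
      forall s1 s2 s3, s1 \in tau -> s2 \in tau -> s3 \in tau ->
        ~ covers3 s1.1 s2.1 s3.1].

Definition component (X : {set T}) (v : T) : {set T} :=
  [set u | (u \notin X) && connect (rel_minus X) v u].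

Definition nbhd (C : {set T}) : {set T} :=
  [set y | (y \notin C) && [exists x in C, e x y]].

Definition cubic_set (X : {set T}) : Prop :=
  #|X| = 4 /\
  [set nbhd (component X v) | v in ~: X] = [set Y : {set T} | (Y \subset X) && (#|Y| == 3)].

Definition cubic_tangle (tau : {set osep T}) : Prop :=
  exists sigma : {set osep T},
    [/\ sigma \subset tau, star sigma,
        forall s, s \in sigma -> separation s /\ sorder s = 3 &
        cubic_set (bag sigma)].

Definition internally_4_connected : Prop :=
  [/\ k_connected 3, 4 < #|T| &
      forall s, proper3 s ->
        (forall x y, x \in separator s -> y \in separator s -> ~~ e x y) /\
        (#|s.1 :\: s.2| = 1 \/ #|s.2 :\: s.1| = 1)].

End Graphs.

Definition torso_vtx (T : finType) (sigma : {set osep T}) : finType :=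
  {x : T | x \in bag sigma}.

Definition torso_rel (T : finType) (e : rel T) (sigma : {set osep T}) :
  rel (torso_vtx sigma) :=
  fun x y => (val x != val y) &&
    (e (val x) (val y) ||
     [exists s in sigma, (val x \in separator s) && (val y \in separator s)]).

Definition isomorphic (V1 V2 : finType) (r1 : rel V1) (r2 : rel V2) : Prop :=
  exists f : V1 -> V2, bijective f /\ forall x y, r2 (f x) (f y) = r1 x y.
Arguments torso_rel {T} e sigma.
Arguments torso_vtx {T} sigma.

(* Main.v *)
(** Cutting a 3-connected graph along a 3-separation that is not a claw, and
    keeping the torso of the side to which the tangle points, is a rewriting
    step on graphs with an orientation of their proper 3-separations. A maximal
    3-chop, read in its claw-freeable order, is a sequence of such steps from G to
    the torso of its splitting star, and maximality says that no step applies to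
    that torso; so both torsos are normal forms of G, and being a normal form
    means being internally 4-connected. Normal forms are unique up to isomorphism
    by Newman's lemma, because any two steps (A,B), (C,D) can be joined. If
    (A u C, B n D) has order at most 3, both results reduce to its torso.
    Otherwise submodularity leaves two cases. Either A lies in D and C in B, and
    the two steps commute; or A and C share exactly two vertices p and q, where p
    is in the separator of (C,D) only and q in that of (A,B) only, and after at
    most one more step each the results are isomorphic, q playing the role of p. The
    non-cubic hypothesis only enters to show that bags have more than four vertices. *)

Require Import Defs.
From mathcomp Require Import all_boot perm zify.
From Stdlib Require Import Classical.
Set Implicit Arguments. Unset Strict Implicit. Unset Printing Implicit Defensive.

(** * Separations of 3-connected graphs *)

(** Every cut needs a side to keep, also in a graph that is already a torso. It is not shown that
    torsos inherit tangles; the axioms of [oriented], in which closure under joins of order at most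
    3 is all that is left of the covering condition, suffice for confluence and pass to torsos.
    Cycles are replaced by the local condition [thick], which a triangle in the small side or one
    edge inside the separator already ensures. This explains the second clause of claw-freeability:
    if two separator vertices are shared with an earlier separation, the earlier cut has made them
    adjacent. Only the small side has to be examined, because the side to which the tangle points
    always contains a cycle. Iterated torsos are never compared directly. Successive cuts are
    recorded by one star in the original graph, and a further cut replaces the members below the new
    separation by that separation. Such a replacement may delete no vertex; it is then an
    isomorphism and not a step. *)

Definition join (T : finType) (s t : osep T) : osep T := (s.1 :|: t.1, s.2 :&: t.2).

Lemma connect_invariant (T : finType) (r : rel T) (P : T -> Prop) x y :
  (forall a b, P a -> r a b -> P b) -> connect r x y -> P x -> P y.
Proof.
move=> clP /connectP[p + ->]; elim: p x => //= z p IHp x /andP[xz pz] Px.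
exact: IHp pz (clP _ _ Px xz).
Qed.

Section Separations.
Variables (T : finType) (e : rel T).
Hypotheses (e_sym : symmetric e) (e_irr : irreflexive e) (G3 : k_connected e 3).
Implicit Types s t u : osep T.

(** The edge condition is used in this one-sided form. Since a vertex outside the second side lies
    in the first, strict sides are written below as [x \notin s.2] and [x \notin s.1]. *)
Lemma separationP s :
  separation e s <->
  (forall x, (x \in s.1) || (x \in s.2)) /\
  (forall x y, e x y -> x \notin s.2 -> y \in s.1).
Proof.
split=> [[U E]|[U E]]; split.
- by move=> x; rewrite -in_setU U inE.
- move=> x y exy xs2; have := E x y; rewrite !inE exy xs2.
  have := in_setT x; have := in_setT y; rewrite -U !inE (negPf xs2) orbF => + ->.
  by case: (y \in s.1) => //= -> /(_ isT isT).
- by apply/setP=> x; rewrite !inE U.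
- move=> x y /setDP[_ xs2] /setDP[_ ys1]; apply: contra ys1 => exy.
  exact: E exy xs2.
Qed.

Lemma separation_flip s : separation e s -> separation e (flip s).
Proof.
move=> /separationP[U E]; apply/separationP; split=> [x|x y exy xs1] /=.
  by rewrite orbC.
apply: contraT => ys2; rewrite e_sym in exy.
by rewrite (E _ _ exy ys2) in xs1.
Qed.

Lemma flipK s : flip (flip s) = s. Proof. by case: s. Qed.

Lemma separation_join s t : separation e s -> separation e t -> separation e (join s t).
Proof.
move=> /separationP[U E] /separationP[U' E']; apply/separationP; split=> [x|x y exy] /=.
  by rewrite !inE; move: (U x) (U' x); do 4!case: (_ \in _).
rewrite !inE negb_and => /orP[/(E _ _ exy)->//|/(E' _ _ exy)->]; exact: orbT.
Qed.

Lemma proper3P s :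
  proper3 e s <->
  [/\ separation e s, exists x, x \notin s.2, exists y, y \notin s.1 & #|separator s| = 3].
Proof.
split=> [[[S [/set0Pn[x /setDP[_ ?]] /set0Pn[y /setDP[_ ?]]] c]]|[S [x xs] [y ys] c]].
  by split=> //; [exists x|exists y].
have /separationP[U _] := S.
split=> //; split=> //; split; apply/set0Pn; [exists x|exists y]; rewrite inE ?xs ?ys.
  by have := U x; rewrite (negPf xs) orbF.
by have := U y; rewrite (negPf ys).
Qed.

Lemma proper3_flip s : proper3 e s -> proper3 e (flip s).
Proof.
move=> /proper3P[S x y c]; apply/proper3P; split=> //; first exact: separation_flip.
by rewrite /separator setIC.
Qed.

Lemma sep_nbr s x y : separation e s -> e x y -> x \notin s.2 -> y \in s.1.
Proof. by move=> /separationP[_]; apply. Qed.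

Lemma sep_nbr2 s x y : separation e s -> e x y -> x \notin s.1 -> y \in s.2.
Proof. by move=> /separation_flip /sep_nbr h; apply: h. Qed.

Lemma sep_cover s x : separation e s -> (x \in s.1) || (x \in s.2).
Proof. by move=> /separationP[]. Qed.

Lemma sep_in1 s x : separation e s -> x \notin s.2 -> x \in s.1.
Proof. by move=> /(sep_cover x); case: (x \in s.2) => //; rewrite orbF. Qed.

Lemma sep_in2 s x : separation e s -> x \notin s.1 -> x \in s.2.
Proof. by move=> /(sep_cover x); case: (x \in s.1). Qed.

Lemma sepvE s x : (x \in separator s) = (x \in s.1) && (x \in s.2).
Proof. by rewrite inE. Qed.

(** Deleting the fewer than three vertices of [X] leaves the graph connected, and [P] absorbs all
    neighbours outside [X], so it takes in every remaining vertex. *)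
Lemma small_cut (X P : {set T}) x y :
  #|X| < 3 -> (forall a b, a \in P -> e a b -> b \notin X -> b \in P) ->
  x \in P -> x \notin X -> y \notin X -> y \in P.
Proof.
case: G3 => _ con cX clP Px nx ny.
apply: (connect_invariant (P := fun z => z \in P)) (con X cX x y nx ny) Px.
by move=> a b Pa /and3P[eab _ nb]; apply: clP eab nb.
Qed.

Lemma order_ge3 s x y : separation e s -> x \notin s.2 -> y \notin s.1 -> 2 < #|separator s|.
Proof.
move=> S xs ys; rewrite ltnNge; apply/negP => c.
suff: y \in ~: s.2 by rewrite inE (sep_in2 S ys).
apply: (small_cut (X := separator s) (x := x)); rewrite ?inE ?(negPf xs) ?(negPf ys) ?andbF //.
move=> a b; rewrite !inE => as2 eab; rewrite (sep_nbr S eab as2) //.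
Qed.

Lemma proper3I s x y : separation e s -> x \notin s.2 -> y \notin s.1 ->
  #|separator s| <= 3 -> proper3 e s.
Proof.
move=> S xs ys c; apply/proper3P; split=> //; [by exists x|by exists y|].
by apply/eqP; rewrite eqn_leq c (order_ge3 S xs ys).
Qed.

Definition nb (x : T) : {set T} := [set y | e x y].

Lemma degree_ge3 x : 2 < #|nb x|.
Proof.
rewrite ltnNge; apply/negP => c; case: (G3) => cT _.
(* With at most two neighbours, [x] and its neighbours do not exhaust the graph, and these
   neighbours would cut [x] off from [w]. *)
have [w]: exists w, w \notin x |: nb x.
  apply/existsP; rewrite -negb_forall; apply/negP=> /forallP h.
  have: #|T| <= #|x |: nb x| by rewrite -cardsT; apply/subset_leq_card/subsetP=> z _; apply: h.
  by rewrite cardsU1; move: c cT; case: (_ \notin _) => /=; lia.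
rewrite !inE negb_or => /andP[wx nw].
suff: w \in [set x] by rewrite inE (negPf wx).
apply: (small_cut (X := nb x) (x := x)); rewrite ?inE ?e_irr //.
by move=> a b /set1P-> exb; rewrite /nb !inE exb.
Qed.

(** Otherwise the two other separator vertices would already cut off the strict first side. *)
Lemma sep_vertex_nbr s x : proper3 e s -> x \in separator s ->
  exists2 y, e x y & y \notin s.2.
Proof.
move=> /proper3P[S [u us] [w ws] c] xs.
have [/existsP[y /andP[]]|/existsPn h] := boolP [exists y, e x y && (y \notin s.2)].
  by exists y.
suff: w \in ~: s.2 by rewrite inE (sep_in2 S ws).
apply: (small_cut (X := separator s :\ x) (x := u)); rewrite ?inE ?(negPf us) ?(negPf ws) ?andbF //.
  by move: c; rewrite (cardsD1 x) xs; lia.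
move=> a b; rewrite !inE => as2 eab; rewrite (sep_nbr S eab as2) /= negb_and negbK.
case/orP=> // /eqP bx; have := h a; rewrite -bx e_sym eab as2 //.
Qed.

Lemma separator_flip s : separator (flip s) = separator s.
Proof. exact: setIC. Qed.

(* For a proper 3-separation of a 3-connected graph: the first side contains a cycle. *)
Definition thick s : Prop :=
  1 < #|s.1 :\: s.2| \/ exists x y, [/\ x \in separator s, y \in separator s & e x y].

(** If the strict side has at most one vertex, two corners of the triangle are in the separator and
    form an edge there. *)
Lemma triangle_thick s x y z : separation e s ->
  (exists v, v \notin s.2) -> uniq [:: x; y; z] ->
  e x y -> e y z -> e x z -> x \in s.1 -> y \in s.1 -> z \in s.1 -> thick s.
Proof.
move=> S [v vs]; rewrite /= !inE negb_or andbT => /andP[/andP[xy xz] yz] exy eyz exz xs ys zs.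
have [|c] := ltnP 1 #|s.1 :\: s.2|; first by left.
right; have int1 a b : a \in s.1 -> b \in s.1 -> a != b -> (a \in s.2) || (b \in s.2).
  move=> aS bS ab; rewrite -[_ || _]negbK negb_or; apply/negP=> /andP[a2 b2].
  have: #|[set a; b]| <= #|s.1 :\: s.2|.
    by apply/subset_leq_card/subsetP=> w /set2P[]->; rewrite inE ?a2 ?b2.
  by rewrite cards2 ab => /leq_trans/(_ c).
have := int1 _ _ xs ys xy; have := int1 _ _ xs zs xz; have := int1 _ _ ys zs yz.
case x2: (x \in s.2) => /=.
  by case/orP=> [y2|z2] _ _; [exists x, y|exists x, z]; rewrite !inE xs x2 ?ys ?zs ?y2 ?z2.
by move=> _ z2 y2; exists y, z; rewrite !inE ys zs y2 z2.
Qed.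

End Separations.

(** * Orientations of 3-separations and their torsos *)

Definition preim_sep (V W : finType) (f : V -> W) (s : osep W) : osep V :=
  (f @^-1: s.1, f @^-1: s.2).

(** What the rewriting uses of a 4-tangle in a 3-connected graph. Together with [or_proper], the
    field [or_join] says that two small sides whose join has order at most 3 never exhaust the
    vertex set. *)
Record oriented (T : finType) (e : rel T) (O : osep T -> Prop) : Prop := Oriented {
  or_sym : symmetric e;
  or_irr : irreflexive e;
  or_conn : k_connected e 3;
  or_proper : forall s, O s -> proper3 e s;
  or_total : forall s, proper3 e s -> O s \/ O (flip s);
  or_asym : forall s, O s -> ~ O (flip s);
  or_join : forall s t, O s -> O t -> #|separator (join s t)| <= 3 -> O (join s t) }.

(** A torso separation is oriented as some element of [O] traces it. That opposite orientations are
    never both traced is proved in [torso_oriented]. *)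
Definition torso_or (T : finType) (e : rel T) (O : osep T -> Prop) (sigma : {set osep T}) :
  osep (torso_vtx sigma) -> Prop :=
  fun s' => proper3 (torso_rel e sigma) s' /\ exists2 s, O s & preim_sep val s = s'.

Lemma clique_side (T : finType) (e : rel T) s (K : {set T}) :
  separation e s -> (forall x y, x \in K -> y \in K -> x != y -> e x y) ->
  K \subset s.1 \/ K \subset s.2.
Proof.
move=> /separationP[U E] cl; have [|/subsetPn[x xK x1]] := boolP (K \subset s.1); first by left.
right; apply/subsetP=> y yK; apply: contraT => y2.
have := U y; rewrite (negPf y2) orbF => y1.
have yx : y != x by apply: contraNneq x1 => <-.
by rewrite (E _ _ (cl _ _ yK xK yx) y2) in x1.
Qed.

Section Oriented.
Variables (T : finType) (e : rel T) (O : osep T -> Prop).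
Hypothesis W : oriented e O.
Implicit Types s t u w : osep T.

Lemma or_sep s : O s -> separation e s.
Proof. by move=> /(or_proper W) /proper3P[]. Qed.

Lemma or_order s : O s -> #|separator s| = 3.
Proof. by move=> /(or_proper W) /proper3P[]. Qed.

Lemma or_int1 s : O s -> exists x, x \notin s.2.
Proof. by move=> /(or_proper W) /proper3P[]. Qed.

Lemma or_int2 s : O s -> exists x, x \notin s.1.
Proof. by move=> /(or_proper W) /proper3P[]. Qed.

(** The separator of a join consists of the separator vertices of either separation that lie in the
    second side of the other. *)
Lemma or_join_sub s t (X : {set T}) : O s -> O t -> #|X| <= 3 ->
  (forall x, x \in s.1 -> x \in s.2 -> x \in t.2 -> x \in X) ->
  (forall x, x \in t.1 -> x \in t.2 -> x \in s.2 -> x \in X) -> O (join s t).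
Proof.
move=> Os Ot cX h1 h2; apply: (or_join W) => //; apply: leq_trans cX.
apply/subset_leq_card/subsetP=> x; rewrite !inE /=.
by case/andP=> /orP[x1|x1] /andP[x2 x3]; [apply: h1|apply: h2].
Qed.

(** Were [flip s] chosen instead, its join with [t] would have its separator inside that of [s],
    while its first side would be the whole vertex set, so it could not be proper. *)
Lemma or_down s t : proper3 e s -> sle s t -> O t -> O s.
Proof.
move=> Ps /andP[/subsetP s1 /subsetP s2] Ot; case: (or_total W Ps) => // Of.
have [_ _ _ c] := (proj1 (proper3P _ _) Ps).
have Oj : O (join (flip s) t).
  apply: (or_join_sub (X := separator s)) => //; rewrite ?c // => x; rewrite !inE //=.
    by move=> -> ->.
  by move=> _ /s2 -> ->.
have [x] := or_int2 Oj; rewrite !inE negb_or => /andP[/= n1 n2].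
have [S _ _ _] := (proj1 (proper3P _ _) Ps).
by have := sep_in1 S n1 => /s1; rewrite (negPf n2).
Qed.

Lemma or_nocover s t : O s -> O t -> ~ sle (flip s) t.
Proof.
move=> Os Ot st; apply: (or_asym W Os); apply: or_down st Ot.
by apply: proper3_flip; [exact: or_sym W|exact: or_proper W _ Os].
Qed.

(** When the separator of [u] lies on one side of [s], the first side of [u] can be moved to that
    side without raising the order: here to the first side of [s], in [or_down1] to the second. *)
Lemma or_up1 s u : O s -> O u -> separator u \subset s.1 -> O (join s u).
Proof.
move=> Os Ou /subsetP us; apply: (or_join_sub (X := separator s)) => //.
- by rewrite or_order.
- by move=> x; rewrite inE => -> ->.
- by move=> x x1 x2 x3; rewrite inE x3 us // inE x1.
Qed.

(** The result is below [s], so only its properness is at stake; the vertex of the last hypothesis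
    keeps the strict first side nonempty. *)
Lemma or_down1 s u : O s -> O u -> separator u \subset s.2 ->
  (exists2 x, x \notin s.2 & x \in u.2) -> O (flip (join (flip s) u)).
Proof.
move=> Os Ou /subsetP us [x xs xu]; apply: (or_down (t := s)) => //.
  have [y ys] := or_int2 Os.
  have S : separation e (flip (join (flip s) u)).
    apply/separation_flip; first exact: or_sym W.
    apply: separation_join; last exact: or_sep.
    by apply: separation_flip; [exact: or_sym W|exact: or_sep].
  apply: (proper3I (or_conn W) (x := x) (y := y)) => //.
  - rewrite !inE negb_or xs /=; apply: contra xs => x1; apply: us.
    by rewrite inE x1.
  - by rewrite !inE negb_and ys.
  - rewrite -(or_order Os); apply/subset_leq_card/subsetP=> z; rewrite !inE /=.
    case/andP=> /andP[z1 z2] /orP[->|z3]; first by rewrite z1.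
    by rewrite z1 us // inE z3.
by rewrite /sle /= subsetIl subsetUl.
Qed.

Section Torso.
Variable sigma : {set osep T}.
Hypotheses (st : star sigma) (sO : forall s, s \in sigma -> O s).
Notation te := (torso_rel e sigma).
Notation tO := (@torso_or T e O sigma).
Notation V := (torso_vtx sigma).

Lemma bagP x : reflect (forall s, s \in sigma -> x \in s.2) (x \in bag sigma).
Proof. exact: bigcapP. Qed.

Lemma notbag x : x \notin bag sigma -> exists2 s, s \in sigma & x \notin s.2.
Proof.
rewrite /bag => h; have [/existsP[s /andP[]]|/existsPn n] := boolP [exists s in sigma, x \notin s.2].
  by exists s.
case/bagP: h => s ss; have := n s; by rewrite ss /= negbK.
Qed.

Lemma separator_bag s x : s \in sigma -> x \in separator s -> x \in bag sigma.
Proof.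
move=> ss; rewrite inE => /andP[x1 x2]; apply/bagP => t ts.
have [<-//|nst] := eqVneq s t.
by have /andP[/subsetP h _] := st ss ts nst; apply: h.
Qed.

Lemma bag_separator s x : s \in sigma -> x \in s.1 -> x \in bag sigma -> x \in separator s.
Proof. by move=> ss x1 /bagP/(_ _ ss) x2; rewrite inE x1. Qed.

Lemma int_uniq s t x : s \in sigma -> t \in sigma -> x \in s.1 -> x \notin t.2 -> s = t.
Proof.
move=> ss ts x1; apply: contraNeq => nst.
by have /andP[/subsetP h _] := st ss ts nst; apply: h.
Qed.

Lemma torso_e (x y : V) : e (val x) (val y) -> te x y.
Proof.
move=> exy; rewrite /torso_rel exy andbT; apply: contraTneq exy => ->.
by rewrite (or_irr W).
Qed.

Lemma torso_s s (x y : V) : s \in sigma -> val x \in separator s -> val y \in separator s ->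
  x != y -> te x y.
Proof.
move=> ss xs ys; rewrite /torso_rel -val_eqE => -> /=; apply/orP; right.
by apply/existsP; exists s; rewrite ss xs.
Qed.

Lemma torsoP (x y : V) :
  reflect (x != y /\ (e (val x) (val y) \/
             exists2 s, s \in sigma & val x \in separator s /\ val y \in separator s))
          (te x y).
Proof.
rewrite /torso_rel val_eqE; apply: (iffP andP) => [[-> /orP[->|/existsP[s]]]|[-> [->|[s ss [xs ys]]]]] //.
- by split=> //; left.
- by case/andP=> ss /andP[]; split=> //; right; exists s.
- by split=> //; apply/orP; right; apply/existsP; exists s; rewrite ss xs.
Qed.

Lemma torso_sym : symmetric te.
Proof.
suff h (x y : V) : te x y -> te y x by move=> x y; apply/idP/idP; apply: h.
case/torsoP=> xy h; apply/torsoP; rewrite eq_sym; split=> //.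
case: h => [|[s ss []]]; first by rewrite (or_sym W); left.
by right; exists s.
Qed.

Lemma torso_irr : irreflexive te.
Proof. by move=> x; rewrite /torso_rel eqxx. Qed.

Lemma torso_preim_side s u (s' : osep V) : s \in sigma -> separation te s' ->
  preim_sep val u = s' -> separator s \subset u.1 \/ separator s \subset u.2.
Proof.
move=> ss + E; rewrite -{}E => S.
have [] := clique_side (K := [set x : V | val x \in separator s]) S.
- by move=> x y; rewrite inE => xs; rewrite inE => ys xy; exact: torso_s ss xs ys xy.
- move=> /subsetP h; left; apply/subsetP=> x xs.
  by move: (h (Sub x (separator_bag ss xs))) (xs); rewrite !inE /= => + xs' => /(_ xs').
- move=> /subsetP h; right; apply/subsetP=> x xs.
  by move: (h (Sub x (separator_bag ss xs))) (xs); rewrite !inE /= => + xs' => /(_ xs').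
Qed.

(** A star member whose strict first side still meets [w.2] is joined to [w]. The hypothesis keeps
    the separator of the join inside that of [w], and [w.2] shrinks until it lies in the bag. *)
Lemma absorb w : O w -> (forall s x, s \in sigma -> x \in separator s -> x \in w.2 -> x \in w.1) ->
  exists2 u, O u & sle w u /\ u.2 \subset bag sigma.
Proof.
have [n] := ubnP #|w.2|; elim: n w => // n IHn w cw Ow h.
have [wb|/subsetPn[x x2 /notbag[s ss xs]]] := boolP (w.2 \subset bag sigma).
  by exists w => //; rewrite /sle !subxx.
have [|||u Ou [/andP[u1 u2] ub]] := IHn (join w s).
- rewrite ltnS in cw; apply: leq_trans cw; apply: proper_card.
  by apply/properP; split; [exact: subsetIl|exists x; rewrite // !inE negb_and xs orbT].
- apply: (or_join_sub (X := separator w)) => //; first exact: sO.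
  + by rewrite or_order.
  + by move=> z; rewrite inE => -> ->.
  + by move=> z z1 z2 z3; rewrite inE z3 (h s) ?inE ?z1.
- move=> t z ts zt; rewrite !inE => /andP[/= z2 _]; by rewrite (h t).
exists u => //; split=> //; apply/andP; split.
  by apply: subset_trans u1; apply: subsetUl.
by apply: (subset_trans u2); apply: subsetIl.
Qed.

(** Otherwise absorbing the star into [w] would give an element of [O] whose second side is
    contained in its first. This keeps separations of the torso nondegenerate on the side to which
    they point. *)
Lemma torso_cover w : O w -> exists x : V, val x \in w.2 /\ val x \notin w.1.
Proof.
move=> Ow; have [/existsP[x /and3P[xb x2 x1]]|/existsPn h] :=
    boolP [exists x, [&& x \in bag sigma, x \in w.2 & x \notin w.1]].
  by exists (Sub x xb).
have {}h x : x \in bag sigma -> x \in w.2 -> x \in w.1.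
  by move=> xb x2; have := h x; rewrite xb x2 /= negbK.
have [|u Ou [/andP[/subsetP u1 /subsetP u2] /subsetP ub]] := absorb Ow.
  by move=> s x ss /(separator_bag ss); apply: h.
have [x xu] := or_int2 Ou; have x2 := sep_in2 (or_sep Ou) xu.
by case/negP: xu; apply/u1/h; [apply: ub|apply: u2].
Qed.

End Torso.
End Oriented.
Arguments torso_s {T e sigma s x y}.

Lemma card_preim_sub (V W : finType) (f : V -> W) (A : {set W}) :
  injective f -> (forall x, x \in A -> exists y, f y = x) -> #|f @^-1: A| = #|A|.
Proof.
move=> fI fA; rewrite -(card_imset (mem (f @^-1: A)) fI); apply: eq_card => x.
apply/imsetP/idP=> [[y]|xA]; first by rewrite !inE => + ->.
by have [y yx] := fA x xA; exists y; rewrite // !inE yx.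
Qed.

Lemma separator_preim (V W : finType) (f : V -> W) s :
  separator (preim_sep f s) = f @^-1: separator s.
Proof. by apply/setP=> x; rewrite !inE. Qed.

Lemma preim_join (V W : finType) (f : V -> W) s t :
  preim_sep f (join s t) = join (preim_sep f s) (preim_sep f t).
Proof. by congr pair; apply/setP=> x; rewrite !inE. Qed.

(** * The orientation induced on a torso *)

Section TorsoOriented.
Variables (T : finType) (e : rel T) (O : osep T -> Prop).
Hypothesis W : oriented e O.
Implicit Types s t u w : osep T.
Variable sigma : {set osep T}.
Hypotheses (st : star sigma) (sO : forall s, s \in sigma -> O s).
Notation te := (torso_rel e sigma).
Notation tO := (@torso_or T e O sigma).
Notation V := (torso_vtx sigma).

(** The separator of a star member is a clique of the torso and lies on one side of [s']; the first
    side of the member is added to that side. The separator gains no vertex this way, and the lift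
    is nested with the star. *)
Lemma torso_lift (s' : osep V) : separation te s' ->
  exists u, [/\ separation e u, preim_sep val u = s', separator u \subset bag sigma &
    forall s, s \in sigma -> sle s u \/ sle s (flip u)].
Proof.
move=> S; pose C s := separator s \subset val @: s'.1.
have CD s : s \in sigma -> ~~ C s -> separator s \subset val @: s'.2.
  move=> ss nC; have [] := clique_side (K := [set x : V | val x \in separator s]) S.
  - by move=> x y; rewrite inE => xs; rewrite inE => ys; apply: torso_s ss xs ys.
  - move=> /subsetP h; case/negP: nC; apply/subsetP=> x xs.
    by apply/imsetP; exists (Sub x (separator_bag st ss xs)); rewrite ?h ?inE //=; rewrite inE in xs.
  - move=> /subsetP h; apply/subsetP=> x xs.
    by apply/imsetP; exists (Sub x (separator_bag st ss xs)); rewrite ?h ?inE //=; rewrite inE in xs.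
pose X := val @: s'.1 :|: \bigcup_(s in sigma | C s) s.1.
pose Y := val @: s'.2 :|: \bigcup_(s in sigma | ~~ C s) s.1.
have Xv (y : V) : (val y \in X) = (y \in s'.1).
  apply/setUP/idP=> [|y1]; last by left; apply: imset_f.
  case=> [/imsetP[z z1 /val_inj->]//|/bigcupP[s /andP[ss Cs] ys]].
  have /(subsetP Cs)/imsetP[z z1 /val_inj->//] := bag_separator ss ys (valP y).
have Yv (y : V) : (val y \in Y) = (y \in s'.2).
  apply/setUP/idP=> [|y1]; last by left; apply: imset_f.
  case=> [/imsetP[z z1 /val_inj->]//|/bigcupP[s /andP[ss Cs] ys]].
  have /(subsetP (CD _ ss Cs))/imsetP[z z1 /val_inj->//] := bag_separator ss ys (valP y).
have Xs s x : s \in sigma -> C s -> x \in s.1 -> x \in X.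
  by move=> ss Cs xs; apply/setUP; right; apply/bigcupP; exists s => //; rewrite ss.
have Ys s x : s \in sigma -> ~~ C s -> x \in s.1 -> x \in Y.
  by move=> ss Cs xs; apply/setUP; right; apply/bigcupP; exists s => //; rewrite ss.
have Xn s x : s \in sigma -> ~~ C s -> x \in X -> x \in s.2.
  move=> ss nC /setUP[/imsetP[y _ ->]|/bigcupP[t /andP[ts Ct] xt]].
    by have /bagP := valP y; apply.
  apply: contraT => x2; have E := int_uniq st ts ss xt x2.
  by rewrite E (negPf nC) in Ct.
have Yn s x : s \in sigma -> C s -> x \in Y -> x \in s.2.
  move=> ss Cs /setUP[/imsetP[y _ ->]|/bigcupP[t /andP[ts Ct] xt]].
    by have /bagP := valP y; apply.
  apply: contraT => x2; have E := int_uniq st ts ss xt x2.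
  by rewrite E Cs in Ct.
have nbag x : x \notin bag sigma -> exists s, [/\ s \in sigma, x \notin s.2 & x \in s.1].
  by case/notbag=> s ss xs; exists s; split=> //; apply: sep_in1 xs; apply: (or_sep W (sO ss)).
have [U E] := proj1 (separationP _ _) S.
exists (X, Y); split.
- apply/separationP; split=> [x|x y exy] /=.
    have [xb|/nbag[s [ss _ xs]]] := boolP (x \in bag sigma).
      by have := U (Sub x xb); rewrite -Xv -Yv.
    have [Cs|Cs] := boolP (C s); first by rewrite (Xs s).
    by rewrite (Ys s) ?orbT.
  move=> xY.
  have [yb|/nbag[s [ss ys2 ys]]] := boolP (y \in bag sigma); last first.
    have [Cs|Cs] := boolP (C s); first by rewrite (Xs s).
    case/negP: xY; apply: (Ys s) => //.
    by apply: (sep_nbr (or_sep W (sO ss)) (x := y)) => //; rewrite (or_sym W).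
  have [xb|/nbag[s [ss xs2 xs]]] := boolP (x \in bag sigma); last first.
    have [Cs|Cs] := boolP (C s); last by rewrite (Ys s) in xY.
    by apply: (Xs s) => //; apply: (sep_nbr (or_sep W (sO ss)) exy).
  have := E (Sub x xb) (Sub y yb); rewrite -Xv -Yv; apply=> //.
  by apply: torso_e W _ _ _ _.
- by case: (s') Xv Yv => a b /= Xv Yv; congr pair; apply/setP=> y; rewrite inE.
- apply/subsetP=> x; rewrite inE => /andP[xX xY]; apply/bagP=> s ss.
  by have [Cs|Cs] := boolP (C s); [apply: Yn xY|apply: Xn xX].
- move=> s ss; have [Cs|Cs] := boolP (C s); [left|right]; apply/andP; split; apply/subsetP=> x /=.
  + exact: Xs.
  + exact: Yn.
  + exact: Ys.
  + exact: Xn.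
Qed.

Lemma torso_separation u : separation e u ->
  (forall s, s \in sigma -> separator s \subset u.1 \/ separator s \subset u.2) ->
  separation te (preim_sep val u).
Proof.
move=> S sd; apply/separationP; split=> [x|x y]; rewrite !inE; first exact: sep_cover S.
case/torsoP=> xy [exy x2|[s ss [xs ys]] x2]; first exact: sep_nbr exy x2.
case: (sd s ss) => /subsetP h; first exact: h.
by rewrite h in x2.
Qed.

Lemma torso_order u : separator u \subset bag sigma ->
  #|separator (@preim_sep V _ val u)| = #|separator u|.
Proof.
move=> /subsetP ub; rewrite separator_preim; apply: card_preim_sub; first exact: val_inj.
by move=> x /ub xb; exists (Sub x xb).
Qed.

Lemma torso_orI u : O u -> separator u \subset bag sigma ->
  (exists2 x, x \in bag sigma & x \notin u.2) ->
  (forall s, s \in sigma -> separator s \subset u.1 \/ separator s \subset u.2) ->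
  tO (preim_sep val u).
Proof.
move=> Ou ub [x xb x2] sd; split; last by exists u.
have [y [y2 y1]] := torso_cover W st sO Ou.
apply/proper3P; split.
- by apply: torso_separation => //; apply: or_sep Ou.
- by exists (Sub x xb); rewrite inE.
- by exists y; rewrite inE.
- by rewrite torso_order // (or_order W).
Qed.

(** Both [u] and its trace have order 3, so no separator vertex of [u] is lost outside the bag. *)
Lemma torso_or_witness (s' : osep V) : tO s' ->
  exists u, [/\ O u, preim_sep val u = s', separator u \subset bag sigma &
     (forall s, s \in sigma -> separator s \subset u.1 \/ separator s \subset u.2)].
Proof.
move=> [/proper3P[S _ _ c] [u Ou Eu]]; exists u; split=> //; last first.
  by move=> s ss; apply: torso_preim_side S Eu.
suff -> : separator u = val @: (separator s').
  by apply/subsetP=> x /imsetP[y _ ->]; apply: valP.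
apply/eqP; rewrite eq_sym eqEcard card_imset; last exact: val_inj.
rewrite c (or_order W Ou) leqnn andbT; apply/subsetP=> x /imsetP[y + ->].
by rewrite -Eu separator_preim inE.
Qed.

(** A walk in the graph is shadowed in the torso: an excursion through the strict first side of a
    star member leaves and re-enters the bag in the separator of that member, which is a clique. *)
Lemma torso_connected : k_connected te 3.
Proof.
split.
  rewrite card_sig; have [s0|[s ss]] := set_0Vmem sigma.
    suff -> : #|[pred x | x \in bag sigma]| = #|T| by case: (or_conn W).
    by apply: eq_card => x; rewrite !inE; apply/bagP => s; rewrite s0 inE.
  have [x [x2 x1]] := torso_cover W st sO (sO ss).
  rewrite -(or_order W (sO ss)).
  have: #|val x |: separator s| <= #|bag sigma|.
    apply/subset_leq_card/subsetP=> z /setU1P[->|]; first exact: valP.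
    exact: separator_bag.
  by rewrite cardsU1 inE (negPf x1).
move=> X cX x y nx ny.
have cX' : #|val @: X| < 3 by rewrite card_imset //; apply: val_inj.
have nX (z : V) : z \notin X -> val z \notin val @: X by rewrite (mem_imset X z val_inj).
pose R z := connect (rel_minus te X) x z.
(* A bag vertex must be reached itself; for a vertex strictly inside a star member it is enough that
   a separator vertex of that member outside [X] is reached. *)
pose P (u : T) := (forall z : V, val z = u -> R z) /\
  (forall s, s \in sigma -> u \notin s.2 -> exists z : V, [/\ z \notin X, val z \in separator s & R z]).
have step (a b : V) : a \notin X -> b \notin X -> R a -> te a b -> R b.
  by move=> aX bX Ra ab; apply: connect_trans Ra (connect1 _); apply/and3P.
have [_ con] := or_conn W.
suff [h _] : P (val y) by apply: h.
apply: (connect_invariant (P := P)) (con _ cX' _ _ (nX x nx) (nX y ny)) _; last first.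
  split=> [z /val_inj->|s ss]; first exact: connect0.
  by have /bagP/(_ _ ss)-> := valP x.
move=> a b [Pa1 Pa2] /and3P[eab aX bX].
have vX (z : V) : val z \notin val @: X -> z \notin X by rewrite (mem_imset X z val_inj).
have [ab|/notbag[s ss as2]] := boolP (a \in bag sigma).
  have Ra := Pa1 (Sub a ab) erefl; split=> [z zb|t tt bt2].
    apply: (step (Sub a ab)) => //; [exact: vX|by apply: vX; rewrite zb|].
    by apply: (torso_e W); rewrite zb.
  exists (Sub a ab); split=> //; first exact: vX.
  rewrite SubK; apply: (bag_separator tt) => //.
  by apply: (sep_nbr (or_sep W (sO tt)) _ bt2); rewrite (or_sym W).
have bs1 := sep_nbr (or_sep W (sO ss)) eab as2.
have [z [zX zs Rz]] := Pa2 s ss as2.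
split=> [y' yb|t tt bt2].
  have [<-//|zy] := eqVneq z y'.
  apply: (step z) => //; first by apply: vX; rewrite yb.
  apply: torso_s zs _ zy => //; rewrite yb; apply: (bag_separator ss) => //.
  by rewrite -yb; apply: valP.
by rewrite -(int_uniq st ss tt bs1 bt2); exists z.
Qed.

(** Totality comes from lifting a torso separation, asymmetry from [torso_cover], and closure under
    joins from the fact that the trace of a join is the join of the traces, with the same order. *)
Lemma torso_oriented : oriented te tO.
Proof.
split.
- exact: torso_sym W _.
- exact: torso_irr.
- exact: torso_connected.
- by move=> s [].
- move=> s' P; have [S [x xs] [y ys] c] := proj1 (proper3P _ _) P.
  have [u [Su Eu ub nst]] := torso_lift S.
  have Pu : proper3 e u.
    apply/proper3P; split=> //.
    + by exists (val x); move: xs; rewrite -Eu inE.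
    + by exists (val y); move: ys; rewrite -Eu inE.
    + by rewrite -c -Eu torso_order.
  case: (or_total W Pu) => Ou; [left|right].
    by split=> //; exists u.
  split; first by apply: proper3_flip => //; apply: torso_sym W _.
  by exists (flip u); rewrite // -Eu.
- move=> s' /torso_or_witness[u [Ou Eu ub _]] /torso_or_witness[w [Ow Ew wb _]].
  have E1 (y : V) : (val y \in u.1) = (val y \in w.2).
    have := congr1 (fun s : osep V => y \in s.1) Eu; have := congr1 (fun s : osep V => y \in s.2) Ew.
    by rewrite !inE => -> ->.
  have E2 (y : V) : (val y \in u.2) = (val y \in w.1).
    have := congr1 (fun s : osep V => y \in s.2) Eu; have := congr1 (fun s : osep V => y \in s.1) Ew.
    by rewrite !inE => -> ->.
  (* On the bag, [w] has the sides of [u] exchanged. So this join has its separator inside that of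
     [u] and no bag vertex strictly in its second side, against [torso_cover]. *)
  have Oj : O (join u w).
    apply: (or_join_sub W (X := separator u)) => //.
    + by rewrite (or_order W).
    + by move=> x; rewrite inE => -> ->.
    + move=> x x1 x2 x3; have xb : x \in bag sigma by apply: (subsetP wb); rewrite inE x1.
      by rewrite inE x3; have /= -> := E1 (Sub x xb); rewrite x2.
  have [y []] := torso_cover W st sO Oj.
  by rewrite !inE -E1 -E2 => /andP[-> ->].
- move=> s' t' /[dup] Os' /torso_or_witness[u [Ou Eu ub us]].
  move=> /[dup] Ot' /torso_or_witness[w [Ow Ew wb ws]] c.
  have jb : separator (join u w) \subset bag sigma.
    apply/subsetP=> x; rewrite !inE /= => /andP[/orP[] x1 /andP[x2 x3]].
      by apply: (subsetP ub); rewrite inE x1.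
    by apply: (subsetP wb); rewrite inE x1.
  rewrite -Eu -Ew -preim_join; apply: torso_orI => //.
  + apply: (or_join W) => //.
    by rewrite -torso_order // preim_join Eu Ew.
  + have [[/proper3P[_ [x xs] _ _] _] _] := (Os', Ot').
    exists (val x); first exact: valP.
    by move: xs; rewrite -Eu !inE negb_and => ->.
  + move=> s ss; case: (us s ss) => h; first by left; apply: subset_trans h (subsetUl _ _).
    case: (ws s ss) => h'; first by left; apply: subset_trans h' (subsetUr _ _).
    by right; rewrite subsetI h.
Qed.

End TorsoOriented.

(** * Rewriting and Newman's lemma *)

(** The orientation belongs to the object, since it decides which cuts are allowed and which side
    survives. *)
Record ograph := OGraph { ov :> finType; oe : rel ov; oo : osep ov -> Prop }.

Definition og_ok (G : ograph) : Prop := oriented (@oe G) (@oo G).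

Definition torso_og (G : ograph) (sigma : {set osep G}) : ograph :=
  OGraph (torso_rel (@oe G) sigma) (@torso_or G (@oe G) (@oo G) sigma).

Definition og_iso (G K : ograph) : Prop := exists f : K -> G,
  [/\ bijective f, forall x y, oe (f x) (f y) = oe x y &
      forall s, oo s <-> oo (preim_sep f s)].

(* K is only identified with the torso through i: this closes reductions under isomorphism. *)
Record is_reduction (G K : ograph) (s : osep G) (i : K -> G) : Prop := IsReduction {
  rd_or : oo s;
  rd_thick : thick (@oe G) s;
  rd_inj : injective i;
  rd_im : forall x, x \in s.2 <-> exists y, i y = x;
  rd_edge : forall x y, oe x y =
    (x != y) && (oe (i x) (i y) || (i x \in separator s) && (i y \in separator s));
  rd_oo : forall s', oo s' <-> proper3 (@oe K) s' /\ exists2 u, oo u & preim_sep i u = s' }.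

Definition reduces (G K : ograph) : Prop :=
  og_ok K /\ exists s i, @is_reduction G K s i.

Definition reduces_eq (G K : ograph) : Prop :=
  og_ok K /\ (reduces G K \/ og_iso G K).

Inductive reaches : ograph -> ograph -> Prop :=
| reaches_iso G K : og_iso G K -> reaches G K
| reaches_step G H K : reduces G H -> reaches H K -> reaches G K.

Definition is_normal (G : ograph) : Prop := forall K, ~ reduces G K.

Lemma star1 (T : finType) (s : osep T) : star [set s].
Proof. by move=> u t /set1P-> /set1P->; rewrite eqxx. Qed.

Lemma bag1 (T : finType) (s : osep T) : bag [set s] = s.2.
Proof. exact: big_set1. Qed.

Lemma in_preim (V W : finType) (f : V -> W) (A : {set W}) x :
  (x \in f @^-1: A) = (f x \in A).
Proof. by rewrite inE. Qed.

Lemma preim_sep_can (V W : finType) (f : V -> W) (g : W -> V) s :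
  cancel f g -> preim_sep f (preim_sep g s) = s.
Proof. by case: s => a b fK; congr pair; apply/setP=> x; rewrite !inE fK. Qed.

Lemma proper3_iso (V W : finType) (e : rel V) (r : rel W) (f : V -> W) s :
  bijective f -> (forall x y, r (f x) (f y) = e x y) ->
  proper3 r s -> proper3 e (preim_sep f s).
Proof.
move=> [g fK gK] fe /proper3P[S [x xs] [y ys] c]; apply/proper3P; split.
- apply/separationP; split=> [z|z w]; rewrite !inE; first exact: sep_cover S.
  by rewrite -fe; apply: sep_nbr.
- by exists (g x); rewrite inE gK.
- by exists (g y); rewrite inE gK.
- rewrite separator_preim card_preim_sub //; first exact: can_inj fK.
  by move=> z _; exists (g z).
Qed.

Lemma thick_iso (V W : finType) (e : rel V) (r : rel W) (f : V -> W) s :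
  bijective f -> (forall x y, r (f x) (f y) = e x y) ->
  thick r s -> thick e (preim_sep f s).
Proof.
move=> [g fK gK] fe [c|[x [y [xs ys exy]]]]; [left|right].
  have -> : (preim_sep f s).1 :\: (preim_sep f s).2 = f @^-1: (s.1 :\: s.2).
    by apply/setP=> z; rewrite !inE.
  rewrite card_preim_sub //; first exact: can_inj fK.
  by move=> z _; exists (g z).
exists (g x), (g y); rewrite separator_preim !in_preim !gK; split=> //.
by rewrite -fe !gK.
Qed.

(** Both orientations are restrictions of the same [O], so an isomorphism that commutes with the
    maps to [T] matches them. *)
Lemma restriction_iso (T V1 V2 : finType) (O : osep T -> Prop) (r1 : rel V1) (r2 : rel V2)
    (i1 : V1 -> T) (i2 : V2 -> T) (f : V2 -> V1) s :
  bijective f -> (forall x y, r1 (f x) (f y) = r2 x y) -> (forall x, i1 (f x) = i2 x) ->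
  (proper3 r1 s /\ exists2 u, O u & preim_sep i1 u = s) <->
  (proper3 r2 (preim_sep f s) /\ exists2 u, O u & preim_sep i2 u = preim_sep f s).
Proof.
move=> bf fe fi; split=> -[P [u uo ui]].
  split; first exact: proper3_iso P.
  by exists u => //; rewrite -ui; congr pair; apply/setP=> x; rewrite !inE fi.
have [g fK gK] := bf.
have E v : preim_sep g (preim_sep f v) = v by apply: preim_sep_can.
have bg : bijective g by exists f.
split.
  rewrite -(E s); apply: proper3_iso P => // x y.
  by rewrite -fe !gK.
by exists u => //; rewrite -(E s) -ui; congr pair; apply/setP=> x; rewrite !inE -fi gK.
Qed.

Lemma og_iso_refl G : og_iso G G.
Proof.
exists id; split=> //; first by exists id.
move=> [a b]; suff -> : preim_sep (fun x : G => x) (a, b) = (a, b) by [].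
by congr pair; apply/setP=> x; rewrite inE.
Qed.

Lemma og_iso_sym G K : og_iso G K -> og_iso K G.
Proof.
move=> [f [[g fK gK] fe fo]]; exists g; split; first by exists f.
  by move=> x y; rewrite -fe !gK.
by move=> s; rewrite fo preim_sep_can.
Qed.

Lemma og_iso_trans G H K : og_iso G H -> og_iso H K -> og_iso G K.
Proof.
move=> [f [bf fe fo]] [g [bg ge go]]; exists (f \o g); split.
- exact: bij_comp.
- by move=> x y /=; rewrite fe ge.
- move=> s; rewrite fo go.
  suff -> : preim_sep (f \o g) s = preim_sep g (preim_sep f s) by [].
  by congr pair; apply/setP=> x; rewrite !inE.
Qed.

Lemma iso_reduces G H K : og_iso G H -> reduces G K -> reduces H K.
Proof.
move=> [f [[g fK gK] fe fo]] [okK [s [i [so sth inj im ed oK]]]].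
split=> //; exists (preim_sep f s), (g \o i); split.
- by apply/fo.
- by apply: thick_iso sth => //; exists g.
- by apply: inj_comp => //; apply: can_inj gK.
- move=> x; rewrite inE im; split=> [[y yx]|[y <-]]; exists y => /=; last by rewrite gK.
  by rewrite yx fK.
- by move=> x y; rewrite ed separator_preim !in_preim /= !gK -fe !gK.
- move=> s'; rewrite oK; split=> -[P [u uo ui]]; split=> //.
    exists (preim_sep f u); first by apply/fo.
    by rewrite -ui; congr pair; apply/setP=> x; rewrite !inE /= gK.
  exists (preim_sep g u); first by rewrite fo preim_sep_can.
  by rewrite -ui; congr pair; apply/setP=> x; rewrite !inE.
Qed.

Lemma iso_reaches G H K : og_iso G H -> reaches G K -> reaches H K.
Proof.
move=> i r; case: r i => [{}G {}K j|{}G H' {}K r1 r2] i.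
  by apply: reaches_iso; apply: og_iso_trans (og_iso_sym i) j.
exact: reaches_step (iso_reduces i r1) r2.
Qed.

Lemma reduction_torso G K s i :
  @is_reduction G K s i -> og_iso (torso_og [set s]) K.
Proof.
move=> [so sth inj im ed oK].
have ib (y : K) : i y \in bag [set s] by rewrite bag1; apply/im; exists y.
pose f (y : K) : torso_vtx [set s] := Sub (i y) (ib y).
have bf : bijective f.
  apply: inj_card_bij; first by move=> x y /(congr1 val) /inj.
  rewrite card_sig -(card_imset _ inj); apply/subset_leq_card/subsetP=> x.
  by rewrite inE bag1 => /im[y <-]; apply: imset_f.
have fe (x y : K) : @oe (torso_og [set s]) (f x) (f y) = oe x y.
  rewrite ed /= /torso_rel /= (inj_eq inj); congr (_ && (_ || _)).
  apply/existsP/idP=> [[t /andP[/set1P->]]//|h]; by exists s; rewrite set11.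
exists f; split=> // s'; rewrite oK.
exact: (restriction_iso _ _ bf).
Qed.

Lemma reduces_card G K : og_ok G -> reduces G K -> #|K| < #|G|.
Proof.
move=> ok [_ [s [i [so _ inj im _ _]]]]; rewrite -(card_imset _ inj) -cardsT.
apply: proper_card; apply/properP; split; first exact: subsetT.
have [x xs] := or_int1 ok so; exists x => //.
by apply: contra xs => /imsetP[y _ ->]; apply/im; exists y.
Qed.

Lemma normal_form_exists G : og_ok G -> exists K, reaches G K /\ is_normal K.
Proof.
have [n] := ubnP #|G|; elim: n G => // n IHn G cG ok.
have [[H r]|nr] := classic (exists H, reduces G H); last first.
  exists G; split; first exact/reaches_iso/og_iso_refl.
  by move=> H r; case: nr; exists H.
have [||K [rK nK]] := IHn H; first by have := reduces_card ok r; lia.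
  by case: r.
by exists K; split=> //; apply: reaches_step r rK.
Qed.

Section Newman.
Hypothesis diamond : forall (G : ograph) (s t : osep G), og_ok G -> oo s -> oo t ->
  thick (@oe G) s -> thick (@oe G) t ->
  exists H K, [/\ reduces_eq (torso_og [set s]) H, reduces_eq (torso_og [set t]) K & og_iso H K].

Lemma reduces_eq_reaches G H K : reduces_eq G H -> reaches H K -> reaches G K.
Proof.
by move=> [_ [r|i]] h; [apply: reaches_step r h|apply: iso_reaches (og_iso_sym i) h].
Qed.

Lemma normal_form_unique G K1 K2 : og_ok G ->
  reaches G K1 -> is_normal K1 -> reaches G K2 -> is_normal K2 -> og_iso K1 K2.
Proof.
have [n] := ubnP #|G|; elim: n G K1 K2 => // n IHn G K1 K2 cG ok r1.
case: r1 cG ok => [{}G {}K1 i|{}G H1 {}K1 s1 r1] cG ok n1 r2.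
  case: r2 i cG ok => [{}G {}K2 j|{}G H2 {}K2 s2 r2] i cG ok n2.
    exact: og_iso_trans (og_iso_sym i) j.
  by case: (n1 H2); apply: iso_reduces i s2.
case: r2 s1 cG ok => [{}G {}K2 j|{}G H2 {}K2 s2 r2] s1 cG ok n2.
  by case: (n2 H1); apply: iso_reduces j s1.
have [ok1 [s [i R1]]] := s1; have [ok2 [t [j R2]]] := s2.
(* The two steps meet again up to isomorphism. A normal form of the meeting point is reached from
   both branches, each of which has fewer vertices than [G]. *)
have [D1 [D2 [d1 d2 d12]]] := diamond ok (rd_or R1) (rd_or R2) (rd_thick R1) (rd_thick R2).
have [N [rN nN]] : exists K, reaches D1 K /\ is_normal K.
  by apply: normal_form_exists; case: d1.
have l1 : og_iso K1 N.
  apply: (IHn H1) => //; first by have := reduces_card ok s1; lia.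
  apply: iso_reaches (reduction_torso R1) _; exact: reduces_eq_reaches d1 rN.
have l2 : og_iso K2 N.
  apply: (IHn H2) => //; first by have := reduces_card ok s2; lia.
  apply: iso_reaches (reduction_torso R2) _.
  by apply: reduces_eq_reaches d2 _; apply: iso_reaches d12 rN.
exact: og_iso_trans l1 (og_iso_sym l2).
Qed.

End Newman.

(** * Enlarging a star *)

Lemma card_ge3P (T : finType) (A : {set T}) : 2 < #|A| ->
  exists x y z, [/\ uniq [:: x; y; z], x \in A, y \in A & z \in A].
Proof.
rewrite cardE; case E: (enum A) => [|x [|y [|z l]]] // _; exists x, y, z.
have := enum_uniq A; rewrite E /= !inE !negb_or => /and4P[/and3P[-> -> _] /andP[-> _] _ _] /=.
by split=> //; rewrite -mem_enum E !inE eqxx ?orbT.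
Qed.

Section Extend.
Variable G : ograph.
Hypothesis ok : og_ok G.
Implicit Types s t u : osep G.
Variables (sigma : {set osep G}) (u : osep G).
Hypotheses (st : star sigma) (sO : forall s, s \in sigma -> oo s) (Ou : oo u).
Hypothesis su : forall s, s \in sigma -> sle s u \/ sle s (flip u).

(** The star that records one more cut along [u]: the members below [u] are cut away with its first
    side. *)
Definition star_extend : {set osep G} := u |: [set s in sigma | ~~ sle s u].

Lemma star_extendP s : s \in star_extend <-> s = u \/ [/\ s \in sigma, ~~ sle s u & sle s (flip u)].
Proof.
rewrite !inE; split.
  case/orP=> [/eqP->|/andP[ss nu]]; [by left|right; split=> //].
  by case: (su ss) => // h; rewrite h in nu.
by case=> [->|[-> -> _]]; rewrite ?eqxx ?orbT.
Qed.

Lemma star_extend_or s : s \in star_extend -> oo s.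
Proof. by case/star_extendP=> [->|[/sO]]. Qed.

Lemma star_extend_star : star star_extend.
Proof.
move=> s t /star_extendP[->|[ss sn sf]] /star_extendP[->|[ts tn tf]].
- by rewrite eqxx.
- by case/andP: tf => t1 t2 _; apply/andP.
- by [].
- exact: st.
Qed.

Let te := torso_rel (@oe G) sigma.
Let te' := torso_rel (@oe G) star_extend.

Lemma sep_extend_bag : separator u \subset bag sigma.
Proof.
apply/subsetP=> x; rewrite inE => /andP[x1 x2]; apply/bagP=> s ss.
by case: (su ss) => /andP[_ /subsetP h]; apply: h.
Qed.

Lemma bag_extend x : (x \in bag star_extend) = (x \in bag sigma) && (x \in u.2).
Proof.
apply/bagP/andP=> [h|[/bagP h x2] s]; last first.
  by case/star_extendP=> [->|[ss _ _]] //; apply: h.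
have x2 : x \in u.2 by apply: h; apply/star_extendP; left.
split=> //; apply/bagP=> s ss.
have [/andP[_ /subsetP]|nsu] := boolP (sle s u); first exact.
by apply: h; rewrite !inE ss nsu orbT.
Qed.

Lemma sep_le_sub s x : sle s u -> x \in separator s -> x \in u.2 -> x \in separator u.
Proof. by move=> /andP[/subsetP h _]; rewrite !inE => /andP[/h-> _]. Qed.

Lemma side_extend s : s \in sigma -> separator s \subset u.1 \/ separator s \subset u.2.
Proof.
move=> ss; case: (su ss) => /andP[h _]; [left|right];
  exact: subset_trans (subsetIl _ _) h.
Qed.

(** A dropped member is below [u], so its separator vertices that stay in the bag belong to the
    separator of [u], and dropping it loses no edge. *)
Lemma torso_extendE (x y : torso_vtx star_extend) (x' y' : torso_vtx sigma) :
  val x' = val x -> val y' = val y ->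
  te' x y = (x != y) && (te x' y' || (val x \in separator u) && (val y \in separator u)).
Proof.
move=> xE yE; rewrite /te /te' /torso_rel xE yE val_eqE.
have [//|xy] := eqVneq x y; rewrite /= -orbA; congr (_ || _).
have := valP x; have := valP y; rewrite !bag_extend => /andP[_ y2] /andP[_ x2].
apply/existsP/orP=> [[s /and3P[/star_extendP[->|[ss _ _]] xs ys]]|].
- by right; rewrite xs.
- by left; apply/existsP; exists s; rewrite ss xs.
case=> [/existsP[s /and3P[ss xs ys]]|/andP[xs ys]]; last first.
  by exists u; rewrite xs ys !andbT; apply/star_extendP; left.
have [lsu|nsu] := boolP (sle s u); last by exists s; rewrite xs ys !inE ss nsu orbT.
exists u; rewrite !(sep_le_sub lsu) // !andbT; apply/star_extendP; by left.
Qed.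

(** A vertex strictly in the first side of [u] is then outside the bag, hence strictly inside a
    member [s], which must be below [u]. The separators of [s] and [u] coincide, so the clique that
    [u] adds was already present. *)
Lemma extend_iso : bag sigma \subset u.2 -> og_iso (torso_og sigma) (torso_og star_extend).
Proof.
move=> /subsetP bu.
have bE x : (x \in bag star_extend) = (x \in bag sigma).
  by rewrite bag_extend; case xb: (x \in _) => //=; apply: bu.
have fb (x : torso_vtx star_extend) : val x \in bag sigma by rewrite -bE; apply: valP.
pose f (x : torso_vtx star_extend) : torso_vtx sigma := Sub (val x) (fb x).
have gb (x : torso_vtx sigma) : val x \in bag star_extend by rewrite bE; apply: valP.
pose g (x : torso_vtx sigma) : torso_vtx star_extend := Sub (val x) (gb x).
have bf : bijective f by exists g => x; apply: val_inj.
have fe x y : te (f x) (f y) = te' x y.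
  rewrite (torso_extendE (x' := f x) (y' := f y)) //.
  have [->|xy] := eqVneq x y; first by rewrite /te /torso_rel eqxx.
  rewrite /=; case E: (te _ _) => //=; apply/esym/negbTE/negP => /andP[xs ys].
  have [w wu] := or_int1 ok Ou.
  have [s ss ws] : exists2 s, s \in sigma & w \notin s.2.
    by apply: notbag; apply: contra wu => /bu.
  have ws1 := sep_in1 (or_sep ok (sO ss)) ws.
  have lsu : sle s u by case: (su ss) => // /andP[/subsetP/(_ _ ws1)]; rewrite (negPf wu).
  have sE : separator s = separator u.
    apply/eqP; rewrite eqEcard !(or_order ok) ?leqnn ?andbT //; last exact: sO.
    apply/subsetP=> x0 xs0; apply: sep_le_sub lsu (xs0) _.
    exact: (bu _ (separator_bag st ss xs0)).
  suff : te (f x) (f y) by rewrite E.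
  apply: torso_s ss _ _ _; rewrite ?sE //.
exists f; split=> // s.
exact: restriction_iso.
Qed.

(** A witness for the smaller torso may cut through separators of members dropped below [u]. As the
    separator of [u] lies on one side of it, all of [u.1] can be moved to that side; the result has
    a trace on the larger torso and is unchanged on the smaller bag. *)
Lemma extend_restriction (s' : osep (torso_og star_extend)) (i : torso_og star_extend -> torso_og sigma) :
  (forall x, val (i x) = val x) ->
  oo s' <-> proper3 te' s' /\ exists2 v : osep (torso_og sigma), oo v & preim_sep i v = s'.
Proof.
move=> iv; have iE v : preim_sep i (preim_sep val v) = preim_sep val v.
  by congr pair; apply/setP=> x; rewrite !inE iv.
split; last first.
  by case=> P [v [_ [w Ow <-]]]; rewrite iE => E; split=> //; exists w.
move=> Os'; split; first by case: Os'.
have [v [Ov Ev vb vs]] := torso_or_witness ok star_extend_star Os'.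
have [x xs] : exists x, x \notin s'.2 by case: Os' => /proper3P[].
have xv : val x \notin v.2 by move: xs; rewrite -Ev inE.
have := valP x; rewrite /= bag_extend => /andP[xb xu].
have vb' : separator v \subset bag sigma.
  by apply: subset_trans vb _; apply/subsetP=> z; rewrite bag_extend => /andP[].
have uE : u \in star_extend by apply/star_extendP; left.
have mid s : s \in sigma -> ~~ sle s u -> separator s \subset u.2.
  move=> ss nsu; case: (su ss) => h; first by rewrite h in nsu.
  by case/andP: h => h _; apply: subset_trans (subsetIl _ _) h.
have low s : s \in sigma -> sle s u -> separator s \subset u.1.
  by move=> ss /andP[h _]; apply: subset_trans (subsetIl _ _) h.
case: (vs u uE) => uv.
  exists (preim_sep val (join v u)).
    apply: (torso_orI ok) => //.
    - exact: (or_up1 ok Ov Ou uv).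
    - apply: subset_trans vb'; apply/subsetP=> z; rewrite !inE /=.
      case/andP=> /orP[z1|z1] /andP[z2 z3]; rewrite z2 andbT //.
      by apply: (subsetP uv); rewrite inE z1.
    - by exists (val x) => //; rewrite inE negb_and xv.
    - move=> s ss; have [lsu|nsu] := boolP (sle s u).
        by left; apply: subset_trans (low s ss lsu) (subsetUr _ _).
      case: (vs s) => [|h|h]; first by rewrite !inE ss nsu orbT.
        by left; apply: subset_trans h (subsetUl _ _).
      by right; rewrite subsetI h mid.
  rewrite iE -Ev; congr pair; apply/setP=> z; rewrite !inE;
    have := valP z; rewrite /= bag_extend => /andP[_ z2].
    case z1: (val z \in v.1) => //=; apply/negbTE; apply: contraFN z1 => z1.
    by apply: (subsetP uv); rewrite inE z1.
  by rewrite z2 andbT.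
exists (preim_sep val (flip (join (flip v) u))).
  apply: (torso_orI ok) => //.
  - by apply: (or_down1 ok Ov Ou uv); exists (val x).
  - apply: subset_trans vb'; apply/subsetP=> z; rewrite !inE /=.
    case/andP=> /andP[z1 z2] /orP[z3|z3]; rewrite z1 //=.
    by apply: (subsetP uv); rewrite inE z3.
  - exists (val x) => //; rewrite inE negb_or xv /=; apply: contra xv => x1.
    by apply: (subsetP uv); rewrite inE x1.
  - move=> s ss; have [lsu|nsu] := boolP (sle s u).
      by right; apply: subset_trans (low s ss lsu) (subsetUr _ _).
    case: (vs s) => [|h|h]; first by rewrite !inE ss nsu orbT.
      by left; rewrite subsetI h mid.
    by right; apply: subset_trans h (subsetUl _ _).
rewrite iE -Ev; congr pair; apply/setP=> z; rewrite !inE;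
  have := valP z; rewrite /= bag_extend => /andP[_ z2].
  by rewrite z2 andbT.
case z1: (val z \in v.2) => //=; apply/negbTE; apply: contraFN z1 => z1.
by apply: (subsetP uv); rewrite inE z1.
Qed.

(** The separator of a member below [u] is a triangle in the first side. Two separator vertices
    shared with a member are adjacent in the torso. If no member is below [u], the strict first side
    of [u] lies in the bag, so thickness in the graph is preserved. *)
Lemma extend_thick :
  (exists2 s, s \in sigma & sle s u) \/ thick (@oe G) u \/
  (exists s x y, [/\ s \in sigma, x != y, x \in separator u, y \in separator u &
                     (x \in separator s) && (y \in separator s)]) ->
  (exists2 x, x \in bag sigma & x \notin u.2) ->
  thick te (preim_sep val u).
Proof.
move=> h [x0 x0b x0u].
have S : separation te (preim_sep val u).
  by apply: torso_separation side_extend; apply: (or_sep ok Ou).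
have tri s : s \in sigma -> sle s u -> thick te (preim_sep val u).
  move=> ss lsu; have c : 2 < #|separator s| by rewrite (or_order ok (sO ss)).
  have [x [y [z [/= uq xs ys zs]]]] := card_ge3P c.
  have h1 w : w \in separator s -> w \in u.1.
    by case/andP: lsu => /subsetP l _; rewrite inE => /andP[/l].
  pose X : torso_vtx sigma := Sub x (separator_bag st ss xs).
  pose Y : torso_vtx sigma := Sub y (separator_bag st ss ys).
  pose Z : torso_vtx sigma := Sub z (separator_bag st ss zs).
  have [xy xz yz] : [/\ X != Y, X != Z & Y != Z].
    move: uq; rewrite !inE negb_or -!val_eqE /= andbT.
    by case/andP=> /andP[].
  apply: (triangle_thick (x := X) (y := Y) (z := Z) S).
  - by exists (Sub x0 x0b); rewrite inE.
  - by rewrite /= !inE negb_or xy xz yz.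
  - exact: (@torso_s _ (@oe G) sigma s X Y ss xs ys xy).
  - exact: (@torso_s _ (@oe G) sigma s Y Z ss ys zs yz).
  - exact: (@torso_s _ (@oe G) sigma s X Z ss xs zs xz).
  - by rewrite inE /= h1.
  - by rewrite inE /= h1.
  - by rewrite inE /= h1.
have [/existsP[s /andP[ss lsu]]|/existsPn ns] := boolP [exists s in sigma, sle s u].
  exact: tri ss lsu.
have edge x y : x \in separator u -> y \in separator u ->
    (forall (X Y : torso_vtx sigma), val X = x -> val Y = y -> te X Y) -> thick te (preim_sep val u).
  move=> xu yu tXY; right.
  exists (Sub x (subsetP sep_extend_bag _ xu)), (Sub y (subsetP sep_extend_bag _ yu)).
  by rewrite separator_preim !in_preim /=; split=> //; apply: tXY.
case: h => [[s ss lsu]|[[c|[x [y [xu yu exy]]]]|[s [x [y [ss xy xu yu /andP[xs ys]]]]]]].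
- exact: tri ss lsu.
- left; have -> : (preim_sep val u).1 :\: (preim_sep val u).2 =
      val @^-1: (u.1 :\: u.2) :> {set torso_vtx sigma} by apply/setP=> z; rewrite !inE.
  rewrite card_preim_sub //; first exact: val_inj.
  move=> x; rewrite inE => /andP[_ x1].
  suff xb : x \in bag sigma by exists (Sub x xb).
  apply/bagP=> s ss; case: (su ss) => [lsu|/andP[_ /subsetP]]; last exact.
  by have := ns s; rewrite ss lsu.
- by apply: edge xu yu _ => X Y XE YE; apply: (torso_e ok); rewrite XE YE.
- apply: edge xu yu _ => X Y XE YE; apply: torso_s ss _ _ _; rewrite ?XE ?YE //.
  by apply: contra xy => /eqP E; rewrite -XE -YE E.
Qed.

Lemma extend_reduces :
  (exists2 s, s \in sigma & sle s u) \/ thick (@oe G) u \/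
  (exists s x y, [/\ s \in sigma, x != y, x \in separator u, y \in separator u &
                     (x \in separator s) && (y \in separator s)]) ->
  reduces_eq (torso_og sigma) (torso_og star_extend).
Proof.
have okE : og_ok (torso_og star_extend).
  exact: (torso_oriented ok star_extend_star star_extend_or).
move=> h; split=> //.
have [|/subsetPn[x0 x0b x0u]] := boolP (bag sigma \subset u.2).
  by move=> /extend_iso; right.
left; split=> //.
have ib (x : torso_vtx star_extend) : val x \in bag sigma.
  by have := valP x; rewrite /= bag_extend => /andP[].
pose i (x : torso_vtx star_extend) : torso_vtx sigma := Sub (val x) (ib x).
exists (preim_sep val u), i; split.
- apply: (torso_orI ok) => //; [exact: sep_extend_bag|by exists x0|exact: side_extend].
- by apply: extend_thick h _; exists x0.
- by move=> x y E; apply: val_inj; exact: (congr1 val E).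
- move=> x; rewrite inE; split=> [x2|[y <-]]; last first.
    by have := valP y; rewrite /= bag_extend => /andP[].
  have xb : val x \in bag star_extend by rewrite bag_extend x2 (valP x).
  by exists (Sub (val x) xb); apply: val_inj.
- move=> x y; rewrite separator_preim !in_preim /=.
  exact: torso_extendE.
- by move=> s'; apply: extend_restriction.
Qed.

End Extend.

(** * Crossing separations *)

Record leaf_cross (T : finType) (s t : osep T) (p q : T) : Prop := LeafCross {
  lc_ps1 : p \in s.1; lc_ps2 : p \notin s.2; lc_pt1 : p \in t.1; lc_pt2 : p \in t.2;
  lc_qt1 : q \in t.1; lc_qt2 : q \notin t.2; lc_qs1 : q \in s.1; lc_qs2 : q \in s.2;
  lc_only : forall x, x \in s.1 -> x \in t.1 -> x = p \/ x = q }.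

Lemma leaf_crossC (T : finType) (s t : osep T) p q : leaf_cross s t p q -> leaf_cross t s q p.
Proof. by case=> *; split=> // x x1 x2; apply/or_comm; auto. Qed.

Section Crossing.
Variables (T : finType) (e : rel T) (O : osep T -> Prop).
Hypothesis W : oriented e O.
Implicit Types s t u v w : osep T.

(** A nonempty strict corner is the strict first side of a separation, whose separator has at least
    three vertices by 3-connectivity. *)
Lemma corner_order s t (X : {set T}) x y :
  separation e s -> separation e t -> x \notin s.2 -> x \notin t.2 -> y \notin s.1 ->
  (forall z, z \in s.1 -> z \in t.1 -> (z \in s.2) || (z \in t.2) -> z \in X) -> 2 < #|X|.
Proof.
move=> S S' xs xt ys h.
have S2 : separation e (flip (join (flip s) (flip t))).
  apply: (separation_flip (or_sym W)); apply: separation_join;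
    by apply: (separation_flip (or_sym W)).
apply: leq_trans (order_ge3 (or_conn W) S2 (x := x) (y := y) _ _) _.
- by rewrite /= !inE negb_or xs.
- by rewrite /= !inE negb_and ys.
- by apply/subset_leq_card/subsetP=> z; rewrite !inE /= => /andP[/andP[z1 z2] z3]; apply: h.
Qed.

(** Write [s] as (A,B) and [t] as (C,D). Counted with multiplicity the separators have six vertices,
    so more than three around the corner of B and D leave at most two around the corner of A and C,
    whose interior is therefore empty. The two remaining corners then fix the sizes of all parts
    near A and C. *)
Lemma crossing s t : O s -> O t -> 3 < #|separator (join s t)| ->
  sle s (flip t) \/ exists p q, leaf_cross s t p q.
Proof.
move=> Os Ot cj.
have [Ss St] := (or_sep W Os, or_sep W Ot).
(* [a] and [b] are the parts of the separator of [t] strictly on the first and second side of [s],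
   [c] and [d] are the parts of the separator of [s] with respect to [t], and [Z] is the centre. *)
pose a := [set x | [&& x \in t.1, x \in t.2, x \in s.1 & x \notin s.2]].
pose b := [set x | [&& x \in t.1, x \in t.2 & x \notin s.1]].
pose c := [set x | [&& x \in s.1, x \in s.2, x \in t.1 & x \notin t.2]].
pose d := [set x | [&& x \in s.1, x \in s.2 & x \notin t.1]].
pose Z := separator s :&: separator t.
have ct : #|a| + #|b| + #|Z| = 3.
  rewrite -(or_order W Ot) -(cardsID s.1 (separator t)) -(cardsID s.2 (separator t :&: s.1)).
  have -> : separator t :&: s.1 :&: s.2 = Z by apply/setP=> x; rewrite !inE; do ?[case: (_ \in _)].
  have -> : separator t :&: s.1 :\: s.2 = a by apply/setP=> x; rewrite !inE; do ?[case: (_ \in _)].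
  have -> : separator t :\: s.1 = b by apply/setP=> x; rewrite !inE; do ?[case: (_ \in _)].
  clear; lia.
have cs : #|c| + #|d| + #|Z| = 3.
  rewrite -(or_order W Os) -(cardsID t.1 (separator s)) -(cardsID t.2 (separator s :&: t.1)).
  have -> : separator s :&: t.1 :&: t.2 = Z by apply/setP=> x; rewrite !inE; do ?[case: (_ \in _)].
  have -> : separator s :&: t.1 :\: t.2 = c by apply/setP=> x; rewrite !inE; do ?[case: (_ \in _)].
  have -> : separator s :\: t.1 = d by apply/setP=> x; rewrite !inE; do ?[case: (_ \in _)].
  clear; lia.
have card3 (X1 X2 X3 : {set T}) : #|X1 :|: X2 :|: X3| <= #|X1| + #|X2| + #|X3|.
  apply: leq_trans (leq_card_setU _ _) _.
  by rewrite leq_add2r leq_card_setU.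
have cj' : 3 < #|b| + #|d| + #|Z|.
  apply: leq_trans cj (leq_trans _ (card3 b d Z)); apply/subset_leq_card/subsetP=> x.
  rewrite !inE /=; move: (sep_cover x Ss) (sep_cover x St); by do ?[case: (_ \in _)].
have ac : #|a| + #|c| + #|Z| <= 2 by move: ct cs cj'; clear; lia.
have [ws wsP] := or_int2 W Os; have [wt wtP] := or_int2 W Ot.
have AC x : x \notin s.2 -> x \in t.2.
  move=> xs; apply: contraT => xt; suff: 2 < #|a| + #|c| + #|Z| by rewrite ltnNge ac.
  apply: leq_trans (card3 a c Z); apply: (corner_order Ss St xs xt wsP) => z z1 z2.
  by rewrite !inE z1 z2 /=; do ?[case: (_ \in _)].
have no0 (A : {set T}) x : #|A| = 0 -> x \in A -> False.
  by move=> /eqP; rewrite cards_eq0 => /eqP->; rewrite inE.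
have [xs xsP] := or_int1 W Os; have [xt xtP] := or_int1 W Ot.
(* If [c] is empty, the strict first side of [t] avoids [s.1], so the corner bounded by [b], [c] and
   [Z] is inhabited. Comparison with [ct] then empties [a]; [AD] is the mirror image. *)
have BC : #|c| = 0 -> 2 < #|b| + #|c| + #|Z|.
  move=> c0; have x1 : xt \notin s.1.
    apply/negP=> x1; apply: (no0 _ xt c0); rewrite !inE x1 xtP (sep_in1 St xtP) !andbT.
    by apply: contraR xtP; apply: AC.
  apply: leq_trans (card3 b c Z); apply: (corner_order (x := xt) (y := xs) (separation_flip (or_sym W) Ss) St) => // z z2.
  by rewrite !inE /= z2 => -> /=; do ?[case: (_ \in _)].
have AD : #|a| = 0 -> 2 < #|a| + #|d| + #|Z|.
  move=> a0; have x1 : xs \notin t.1.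
    apply/negP=> x1; apply: (no0 _ xs a0); rewrite !inE x1 xsP (sep_in1 Ss xsP) !andbT /=.
    exact: AC.
  apply: leq_trans (card3 a d Z); apply: (corner_order (x := xs) (y := xt) (separation_flip (or_sym W) St) Ss) => // z z2.
  by rewrite !inE /= z2 => -> /=; do ?[case: (_ \in _)].
have [n0|n0] := leqP (#|a| + #|c|) 0.
  have [a0 c0] : #|a| = 0 /\ #|c| = 0 by move: n0; clear; lia.
  left; apply/andP; split; apply/subsetP=> x x1; apply: contraT => x2 /=.
    have y1 := sep_in1 St x2.
    case: (no0 _ x c0); rewrite !inE x1 x2 y1 !andbT /=.
    by apply: contraR x2; apply: AC.
  have y1 := sep_in1 Ss x2.
  by case: (no0 _ x a0); rewrite !inE x1 x2 y1 (AC _ x2).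
(* [a] and [c] vanish together, so if one of them is nonempty, the bound 2 in [ac] leaves one vertex
   in each and an empty centre. *)
have [a1 c1 Z0] : [/\ #|a| = 1, #|c| = 1 & #|Z| = 0].
  have : #|a| = 0 -> #|c| = 0 by move=> a0; have := AD a0; move: cs a0; clear; lia.
  have : #|c| = 0 -> #|a| = 0 by move=> c0; have := BC c0; move: ct c0; clear; lia.
  by move: n0 ac; move: #|a| #|c| #|Z|; clear=> i j k *; split; lia.
move/eqP: a1 => /cards1P[p ap]; move/eqP: c1 => /cards1P[q cq].
have : p \in a by rewrite ap set11.
have : q \in c by rewrite cq set11.
rewrite !inE => /and4P[q1 q2 q3 q4] /and4P[p1 p2 p3 p4].
right; exists p, q; split=> // x x1 x2.
have [x3|x3] := boolP (x \in s.2); have [x4|x4] := boolP (x \in t.2).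
- by case: (no0 Z x) => //; rewrite !inE x1 x2 x3.
- by right; apply/set1P; rewrite -cq !inE x1 x2 x3.
- by left; apply/set1P; rewrite -ap !inE x1 x2 x3 x4.
- by rewrite (AC _ x3) in x4.
Qed.

End Crossing.

(** * The crossing with two common vertices: shifting a separation *)

Section Leaf.
Variable G : ograph.
Hypothesis ok : og_ok G.
Implicit Types s t u v w : osep G.

(* The bag and the torso obtained from s together with t, where t is shifted
   from p to q (and dropped when this shift is no longer proper). *)
Definition leaf_star (s t : osep G) (p q : G) (sigma : {set osep G}) : Prop :=
  [/\ star sigma, forall u, u \in sigma -> oo u,
      forall x, (x \in bag sigma) = (x \in s.2) && ((x \in t.2) || (x == q)) &
      forall x y : torso_vtx sigma, torso_rel (@oe G) sigma x y =
        (x != y) && [|| oe (val x) (val y),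
          (val x \in separator s) && (val y \in separator s) |
          ((val x == q) || (val x \in separator t)) && ((val y == q) || (val y \in separator t))]].

Lemma or_set1 s : oo s -> forall u, u \in [set s] -> oo u.
Proof. by move=> Os u /set1P->. Qed.

(** All neighbours of [p] lie in [s.1], which meets [t.1] only in [p] and [q]. So [p] can leave
    [t.1] if [q] enters the separator, and the shifted separation is nested with [s]. If the shift
    is not proper, the torso of [s] alone already has the required edges. *)
Lemma leaf_star_exists s t p q : oo s -> oo t -> thick (@oe G) t -> leaf_cross s t p q ->
  exists2 sigma, leaf_star s t p q sigma & reduces_eq (torso_og [set s]) (torso_og sigma).
Proof.
move=> Os Ot th [ps1 ps2 pt1 pt2 qt1 qt2 qs1 qs2 only].
have [Ss St] := (or_sep ok Os, or_sep ok Ot).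
have sq x : x \in s.1 -> x \in t.1 -> x != p -> x = q by move=> x1 x2; case: (only x) => // ->; rewrite eqxx.
have qp : q != p by apply: contraNneq qt2 => ->.
have tn x : x \in s.2 -> x \notin t.2 -> x != p by move=> xs _; apply: contraNneq ps2 => <-.
have pn x : x \in t.1 -> x != p -> x != q -> ~~ oe p x.
  move=> x1 xp xq; apply: contra xq => /(sep_nbr Ss)/(_ ps2) xs1; apply/eqP; exact: sq.
have [/existsP[v /andP[vt vq]]|/existsPn nv] := boolP [exists v, (v \notin t.2) && (v != q)].
  pose t' : osep G := (t.1 :\ p, q |: t.2).
  have St' : separation (@oe G) t'.
    apply/separationP; split=> [x|x y exy] /=; rewrite !inE.
      by case: eqP => [->|_] /=; rewrite ?pt2 ?orbT //; case/orP: (sep_cover x St) => ->; rewrite ?orbT.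
    rewrite negb_or => /andP[xq x2]; rewrite (sep_nbr St exy x2) andbT.
    apply: contraNneq (pn x (sep_in1 St x2) _ xq) => [<-|]; first by rewrite (or_sym ok).
    by apply: contraNneq x2 => ->.
  have vt1 := sep_in1 St vt.
  have Ot' : oo t'.
    apply: (or_down ok (t := t)) => //; last by rewrite /sle /= subsetDl subsetUr.
    have [y yt] := or_int2 ok Ot.
    apply: (proper3I (or_conn ok) (x := v) (y := y)) => //.
    - by rewrite !inE negb_or vq.
    - by rewrite !inE (negPf yt) andbF.
    - rewrite -(or_order ok Ot).
      apply: leq_trans (subset_leq_card (B := q |: (separator t :\ p)) _) _.
        apply/subsetP=> x; rewrite !inE => /andP[/andP[-> ->]] /orP[->|->] //.
        by rewrite orbT.
      rewrite (cardsD1 p (separator t)) !inE pt1 pt2 cardsU1.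
      by case: (_ \notin _).
  have nst : ~~ sle s t'.
    by apply/negP=> /andP[/subsetP/(_ _ ps1)]; rewrite !inE eqxx.
  have lst : sle s (flip t').
    apply/andP; split; apply/subsetP=> x; rewrite !inE /=.
      move=> x1; have [x2|x2] := boolP (x \in t.2); first by rewrite orbT.
      rewrite (sq x) ?eqxx //; first exact: sep_in1 St x2.
      by apply: contraNneq x2 => ->.
    case/andP=> xp x1; apply: contraT => x2.
    by case: (only x) => // [|E|E]; [exact: sep_in1 Ss x2|rewrite E eqxx in xp|rewrite E qs2 in x2].
  have su u : u \in [set s] -> sle u t' \/ sle u (flip t') by move=> /set1P->; right.
  have qE : q \in separator t' by rewrite !inE qp qt1 eqxx.
  have vE : v \in t'.1 by rewrite !inE vt1 andbT; apply: contraNneq vt => ->.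
  exists (star_extend [set s] t'); last first.
    apply: extend_reduces; [done|exact: star1|exact: or_set1|done|done|right; left].
    (* If [v] is the only strict vertex, [q] has a neighbour in the shifted separator, since
       otherwise its neighbours would be among [p] and [v], fewer than three. *)
    have [|cv] := ltnP 1 #|t'.1 :\: t'.2|; [by left|right].
    have vI : v \in t'.1 :\: t'.2 by rewrite inE vE !inE negb_or vq vt.
    have Iv x : x \in t'.1 -> x \notin t'.2 -> x = v.
      move=> x1 x2; have /set1P // : x \in [set v].
      suff <- : t'.1 :\: t'.2 = [set v] by rewrite inE x1 x2.
      by apply/esym/eqP; rewrite eqEcard sub1set vI cards1.
    have [/existsP[x /andP[xs eqx]]|/existsPn nx] :=
      boolP [exists x, (x \in separator t') && oe q x]; first by exists q, x.
    have := degree_ge3 (or_irr ok) (or_conn ok) q; rewrite ltnNge => /negP[].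
    apply: leq_trans (subset_leq_card (B := [set p; v]) _) _; last by rewrite cards2; case: (_ != _).
    apply/subsetP=> x; rewrite inE => eqx; have x1 := sep_nbr St eqx qt2.
    have := nx x; rewrite eqx andbT !inE; have [//|xp] := eqVneq x p.
    rewrite x1 /= negb_or => /andP[xq x2]; apply/eqP/Iv; first by rewrite !inE xp.
    by rewrite !inE negb_or xq.
  split.
  - exact: star_extend_star (@star1 _ s) su.
  - exact: star_extend_or (or_set1 Os) Ot' su.
  - by move=> x; rewrite bag_extend // bag1 /t' /= !inE orbC.
  - move=> x y; have [xb yb] := (valP x, valP y).
    have xB : val x \in bag [set s] by move: xb; rewrite /= bag_extend // => /andP[].
    have yB : val y \in bag [set s] by move: yb; rewrite /= bag_extend // => /andP[].
    rewrite (torso_extendE su (x' := Sub (val x) xB) (y' := Sub (val y) yB)) //.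
    have [//|xy] := eqVneq x y; rewrite /torso_rel /= val_eqE xy /= -orbA; congr (_ || _).
    have tE (z : G) : z \in bag [set s] -> (z \in separator t') = (z == q) || (z \in separator t).
      rewrite bag1 => z2; rewrite !inE; have [->|zq] := eqVneq z q; first by rewrite qp qt1.
      have -> : z != p by apply: contraNneq ps2 => <-.
      by rewrite andTb.
    rewrite !tE //; congr (_ || _); apply/existsP/idP => [[u /andP[/set1P->]]//|h].
    by exists s; rewrite set11.
exists [set s]; last first.
  split; last by right; apply: og_iso_refl.
  exact: (torso_oriented ok (@star1 _ s) (or_set1 Os)).
(* Now [q] is the only strict vertex of [t.1]. Its neighbourhood is the whole separator of [t], and
   thickness of [t] gives an edge in that separator; this edge avoids [p], which has no neighbour
   there, so it joins the two other vertices. *)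
have tq x : x \notin t.2 -> x = q by move=> x2; have := nv x; rewrite x2 /= negbK => /eqP.
split.
- exact: star1.
- exact: or_set1.
- move=> x; rewrite bag1; case x2: (x \in s.2) => //=; apply/esym.
  by have [//|/tq->] := boolP (x \in t.2); rewrite eqxx.
- move=> x y; have v2 (z : torso_vtx [set s]) : val z \in s.2 by rewrite -bag1; apply: valP.
  have [x2 y2] := (v2 x, v2 y).
  rewrite /torso_rel val_eqE; have [//|xy] := eqVneq x y; rewrite /=.
  have -> : [exists u in [set s], (val x \in separator u) && (val y \in separator u)] =
      (val x \in separator s) && (val y \in separator s).
    by apply/existsP/idP => [[u /andP[/set1P->]]//|h]; exists s; rewrite set11.
  have nbq z : z \in separator t -> oe q z.
    have /eqP E : nb (@oe G) q == separator t.
      rewrite eqEcard (or_order ok Ot) (degree_ge3 (or_irr ok) (or_conn ok) q) andbT.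
      apply/subsetP=> r; rewrite !inE => eqr; rewrite (sep_nbr St eqr qt2) /=.
      by apply: contraTT eqr => /tq->; rewrite (or_irr ok).
    by rewrite -E inE.
  have zp z : z \in s.2 -> z != p by apply: contraTneq => ->.
  suff h (z w : G) : z \in s.2 -> w \in s.2 -> z != w ->
      (z == q) || (z \in separator t) -> (w == q) || (w \in separator t) -> oe z w.
    rewrite orbA; case E: (_ || _ && _) => //=; apply/esym/negbTE/negP=> /andP[xQ yQ].
    by move: E; rewrite h // val_eqE.
  move=> z2 w2 zw /orP[/eqP zq|zt] /orP[/eqP wq|wt].
  + by rewrite zq wq eqxx in zw.
  + by rewrite zq; apply: nbq.
  + by rewrite wq (or_sym ok); apply: nbq.
  case: th => [c|[a [b [at' bt' eab]]]].
    move: c; rewrite ltnNge => /negP[]; rewrite -(cards1 q).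
    apply/subset_leq_card/subsetP=> r /setDP[_ r2].
    by apply/set1P/tq.
  have nq r : r \in separator t -> r != q by rewrite inE => /andP[_ r2]; apply: contraNneq qt2 => <-.
  have np r : r \in separator t -> ~~ oe p r.
    move=> rt; have [->|rp] := eqVneq r p; first by rewrite (or_irr ok).
    have rt1 : r \in t.1 by move: rt; rewrite inE => /andP[].
    exact: (pn r rt1 rp (nq r rt)).
  have ap : a != p by apply: contraTneq eab => ->; apply: np.
  have bp : b != p by apply: contraTneq eab => ->; rewrite (or_sym ok); apply: np.
  have ab : a != b by apply: contraTneq eab => ->; rewrite (or_irr ok).
  have c2 : #|separator t :\ p| = 2.
    by have := or_order ok Ot; rewrite (cardsD1 p) !inE pt1 pt2; move=> /eqP; rewrite eqSS => /eqP.
  have /eqP E : [set a; b] == separator t :\ p.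
    rewrite eqEcard c2 cards2 ab andbT; apply/subsetP=> r.
    by case/set2P=> ->; rewrite in_setD1 ?ap ?bp.
  have : z \in [set a; b] by rewrite E in_setD1 zp.
  have : w \in [set a; b] by rewrite E in_setD1 zp.
  move=> /set2P[] wE /set2P[] zE; move: zw; rewrite zE wE ?eqxx // => _.
  by rewrite (or_sym ok).
Qed.

End Leaf.

(** * The crossing with two common vertices: the transposition of [p] and [q] *)

Section LeafSwap.
Variable G : ograph.
Hypothesis ok : og_ok G.
Implicit Types s t u v w : osep G.

(** Both bags consist of [s.2 :&: t.2] and one more vertex, [q] for [sigma1] and [p] for
    [sigma2]. *)
Lemma leaf_bag_swap s t p q sigma1 sigma2 x : leaf_cross s t p q ->
  leaf_star s t p q sigma1 -> leaf_star t s q p sigma2 ->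
  x \in bag sigma2 -> tperm p q x \in bag sigma1.
Proof.
case=> ps1 ps2 pt1 pt2 qt1 qt2 qs1 qs2 only [_ _ b1 _] [_ _ b2 _].
rewrite b2 b1 => /andP[xt /orP[xs|/eqP->]]; last by rewrite tpermL qs2 eqxx orbT.
rewrite tpermD ?xs ?xt //.
  by apply: contraNneq ps2 => ->.
by apply: contraNneq qt2 => ->.
Qed.

(* The sides of v are first pushed off s, then off t; the edge pq is crossed on the way. *)
Lemma leaf_restrict s t p q sigma (s' : osep (torso_vtx sigma)) :
  oo s -> oo t -> leaf_cross s t p q -> leaf_star s t p q sigma ->
  torso_or (@oe G) (@oo G) s' ->
  exists2 w, oo w & forall z, (tperm p q (val z) \in w.1) = (z \in s'.1) /\
                              (tperm p q (val z) \in w.2) = (z \in s'.2).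
Proof.
move=> Os Ot [ps1 ps2 pt1 pt2 qt1 qt2 qs1 qs2 only] [st sO bE eE] Os'.
have [v [Ov Ev vb _]] := torso_or_witness ok st Os'.
have [Ss St] := (or_sep ok Os, or_sep ok Ot).
case: Os' => P _; have [S' [x0 x0P] [y0 y0P] _] := proj1 (proper3P _ _) P.
have v1 (z : torso_vtx sigma) : (val z \in v.1) = (z \in s'.1) by rewrite -Ev inE.
have v2 (z : torso_vtx sigma) : (val z \in v.2) = (z \in s'.2) by rewrite -Ev inE.
(* Apart from [p], which is outside the bag, this is the clique contributed to the torso by the
   shifted [t]. *)
pose Q x := (x == q) || (x \in separator t).
have sb x : x \in separator s -> x \in bag sigma.
  rewrite bE sepvE => /andP[x1 ->] /=; have [//|x2] := boolP (x \in t.2).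
  have [E|->] := only x x1 (sep_in1 St x2); last exact: eqxx.
  by rewrite E pt2 in x2.
have Qb x : x != p -> Q x -> x \in bag sigma.
  move=> xp /orP[/eqP->|]; rewrite bE ?qs2 ?eqxx ?orbT // sepvE => /andP[x1 x2].
  rewrite x2 andbT; apply: contraT => /(sep_in1 Ss) x3.
  have [E|E] := only x x3 x1; first by rewrite E eqxx in xp.
  by rewrite E (negPf qt2) in x2.
have sides : (forall x, x \in separator s -> x \in v.1) \/ (forall x, x \in separator s -> x \in v.2).
  have [] := clique_side (K := [set x : torso_vtx sigma | val x \in separator s]) S'.
  - move=> x y; rewrite inE => xs; rewrite inE => ys xy.
    by rewrite eE xy xs ys orbT.
  - move=> /subsetP h; left=> x xs.
    have := h (Sub x (sb x xs)); rewrite inE /= => /(_ xs).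
    by rewrite -v1.
  - move=> /subsetP h; right=> x xs.
    have := h (Sub x (sb x xs)); rewrite inE /= => /(_ xs).
    by rewrite -v2.
have sidesQ : (forall x, x != p -> Q x -> x \in v.1) \/ (forall x, x != p -> Q x -> x \in v.2).
  have [] := clique_side (K := [set x : torso_vtx sigma | Q (val x)]) S'.
  - move=> x y; rewrite inE => xs; rewrite inE => ys xy.
    by move: xs ys; rewrite eE xy /Q => -> ->; rewrite !orbT.
  - move=> /subsetP h; left=> x xp xs.
    have := h (Sub x (Qb x xp xs)); rewrite inE /= => /(_ xs).
    by rewrite -v1.
  - move=> /subsetP h; right=> x xp xs.
    have := h (Sub x (Qb x xp xs)); rewrite inE /= => /(_ xs).
    by rewrite -v2.
have qp : q != p by apply: contraNneq qt2 => ->.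
have qb : q \in bag sigma by apply: Qb => //; rewrite /Q eqxx.
pose q' : torso_vtx sigma := Sub q qb.
have Qq : Q q by rewrite /Q eqxx.
have qs : q \in separator s by rewrite inE qs1.
(* All torso neighbours of [q] lie in the two cliques. If both cliques are on one side of [v], then
   [q] is no separator vertex, as it would need a neighbour strictly on the other side. *)
have nbq (y : torso_vtx sigma) : torso_rel (@oe G) sigma q' y ->
    (val y \in separator s) \/ (val y != p /\ Q (val y)).
  have yp : val y != p.
    by apply: contraTneq (valP y) => /= ->; rewrite bE (negPf ps2).
  rewrite eE => /andP[_ /or3P[qy|/andP[_]|/andP[_]]]; [|by left|by right].
  right; split=> //; have := valP y; rewrite /= bE => /andP[_ /orP[y2|/eqP->]]; last exact: Qq.
  by rewrite /Q inE y2 (sep_nbr St qy qt2) orbT.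
have c3 := torso_connected ok st sO.
have tsym : symmetric (torso_rel (@oe G) sigma) by exact: (torso_sym ok).
have q_in1 : (forall x, x \in separator s -> x \in v.1) ->
    (forall x, x != p -> Q x -> x \in v.1) -> q \notin v.2.
  move=> h1 h2; apply/negP=> q2; have q1 := h1 q qs.
  have [||y qy yn] := sep_vertex_nbr tsym c3 (s := flip s') (x := q') _ _.
  - exact: proper3_flip.
  - by rewrite separator_flip inE -v1 -v2 /= q1 q2.
  - by case/negP: yn; rewrite /= -v1; case: (nbq y qy) => [/h1|[/h2]].
have q_in2 : (forall x, x \in separator s -> x \in v.2) ->
    (forall x, x != p -> Q x -> x \in v.2) -> q \notin v.1.
  move=> h1 h2; apply/negP=> q1; have q2 := h1 q qs.
  have [|y qy yn] := sep_vertex_nbr tsym c3 (x := q') P _.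
  - by rewrite inE -v1 -v2 /= q1 q2.
  - by case/negP: yn; rewrite /= -v2; case: (nbq y qy) => [/h1|[/h2]].
have x0v : val x0 \notin v.2 by rewrite v2.
have y0v : val y0 \notin v.1 by rewrite v1.
have bs (z : torso_vtx sigma) : val z \in s.2 by have := valP z; rewrite /= bE => /andP[].
have zp (z : torso_vtx sigma) : val z != p.
  by apply: contraTneq (bs z) => ->.
(* [w] is [v] with all of [s.1] moved to the side that contains the separator of [s]; thus [p] is
   strictly on that side. *)
have [w [Ow [wb1 wb2] wp]] : exists w, [/\ oo w,
    (forall x, x \in bag sigma -> (x \in w.1) = (x \in v.1)) /\
    (forall x, x \in bag sigma -> (x \in w.2) = (x \in v.2)) &
    [/\ p \in w.1, p \notin w.2 & forall x, x \in separator s -> x \in v.1] \/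
    [/\ p \notin w.1, p \in w.2 & forall x, x \in separator s -> x \in v.2]].
  case: sides => h.
    exists (join v s); split; first by apply: (or_up1 ok Ov Os); apply/subsetP.
      split=> x; rewrite bE !inE /= => /andP[x2 _]; rewrite ?x2 ?andbT //.
      case x1: (x \in s.1); rewrite ?orbF // orbT; apply/esym/h.
      by rewrite inE x1.
    by left; rewrite !inE ps1 (negPf ps2) andbF orbT.
  exists (flip (join (flip v) s)); split.
  - apply: (or_down1 ok Ov Os); first exact/subsetP.
    by exists (val x0).
  - split=> x; rewrite bE !inE /= => /andP[x2 _]; rewrite ?x2 ?andbT //.
    case x1: (x \in s.1); rewrite ?orbF // orbT; apply/esym/h.
    by rewrite inE x1.
  - by right; rewrite !inE ps1 (negPf ps2) andbF orbT.
(* Moving [t.1] to one side removes [q], which is outside [t.2], from the separator and may bring in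
   [p]. The flag [b] tells whether [p] enters; the order stays at most 3 because [q] was a separator
   vertex in that case. *)
pose X b := if b then p |: (separator w :\ q) else separator w.
have cX (b : bool) : (b -> (q \in v.1) && (q \in v.2)) -> #|X b| <= 3.
  case: b => [/(_ isT) /andP[q1 q2]|_]; last by rewrite /X (or_order ok Ow).
  rewrite -(or_order ok Ow) (cardsD1 q (separator w)) inE wb1 // wb2 // q1 q2 cardsU1.
  by case: (_ \notin _).
have XI b x : x \in separator w -> x \in t.2 -> x \in X b.
  move=> xw xt; rewrite /X; case: b => //; rewrite !inE.
  by move: xw; rewrite inE => ->; rewrite (_ : x != q) ?orbT //; apply: contraTneq xt => ->.
have Xp : p \in X true by rewrite !inE eqxx.
have tbag x : x \in t.1 -> x \in t.2 -> x != p -> Q x /\ x \in bag sigma.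
  move=> x1 x2 xp; have Qx : Q x by rewrite /Q inE x1 x2 orbT.
  by split=> //; apply: Qb.
have perm_z (z : torso_vtx sigma) :
   (val z = q /\ tperm p q (val z) = p) \/ [/\ val z \in t.2, val z \in bag sigma & tperm p q (val z) = val z].
  have zb := valP z; have [zq|zq] := eqVneq (val z) q; [left|right].
    by rewrite zq tpermR.
  have z2 : val z \in t.2 by move: zb; rewrite bE (negPf zq) orbF => /andP[].
  by split=> //; rewrite tpermD // eq_sym.
case: sidesQ => hQ.
  have q1 : q \in v.1 by apply: hQ.
  exists (join w t).
    apply: (or_join_sub ok (X := X (p \in w.2))) => //.
    - apply: cX => p2; rewrite q1 /=; case: wp => [[_]|[_ _ h]]; first by rewrite p2.
      exact: h.
    - by move=> x x1 x2; apply: XI; rewrite inE x1.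
    - move=> x x1 x2 xw; have [E|xp] := eqVneq x p; first by move: xw; rewrite E => p2; rewrite p2.
      have [Qx xb] := tbag x x1 x2 xp; apply: XI => //.
      by rewrite inE xw wb1 // hQ.
  move=> z; case: (perm_z z) => [[zq ->]|[z2 zb ->]]; rewrite -v1 -v2 !inE /=.
    rewrite zq q1 pt1 pt2 orbT andbT; split=> //.
    case: wp => [[_ p2 h]|[_ p2 h]]; last by rewrite p2 h.
    by rewrite (negPf p2); apply/esym/negbTE/q_in1.
  rewrite z2 andbT wb1 // wb2 //; split=> //.
  case z1: (val z \in t.1); rewrite ?orbF // orbT; apply/esym.
  by apply: hQ; [exact: zp|case: (tbag _ z1 z2 (zp z))].
have q2 : q \in v.2 by apply: hQ.
exists (flip (join (flip w) t)).
  apply: (or_down ok (t := w)) => //; last by rewrite /sle /= subsetIl subsetUl.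
  have [y yw] := or_int2 ok Ow.
  apply: (proper3I (or_conn ok) (x := val x0) (y := y)).
  - apply: (separation_flip (or_sym ok)); apply: separation_join => //.
    by apply: (separation_flip (or_sym ok)); apply: (or_sep ok Ow).
  - rewrite !inE negb_or /= wb2; last exact: (valP x0).
    rewrite x0v /=; apply/negP=> x1.
    case: (perm_z x0) => [[x0q _]|[x2 _ _]]; first by rewrite x0q q2 in x0v.
    by case/negP: x0v; apply: hQ; [exact: zp|case: (tbag _ x1 x2 (zp x0))].
  - by rewrite !inE negb_and yw.
  - apply: leq_trans (cX (p \in w.1) _); last first.
      move=> p1; rewrite q2 andbT; case: wp => [[_ _ h]|[]]; last by rewrite p1.
      exact: h.
    apply/subset_leq_card/subsetP=> x; rewrite !inE /= => /andP[/andP[x1 x2] /orP[xw|xt]].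
      by apply: XI; rewrite // inE x1.
    have [E|xp] := eqVneq x p; first by move: x1; rewrite E => p1; rewrite p1.
    have [Qx xb] := tbag x xt x2 xp; apply: XI => //.
    by rewrite inE x1 wb2 // hQ.
move=> z; case: (perm_z z) => [[zq ->]|[z2 zb ->]]; rewrite -v1 -v2 !inE /=.
  rewrite zq q2 pt1 pt2 orbT andbT; split=> //.
  case: wp => [[p1 _ h]|[p1 _ h]]; first by rewrite p1 h.
  by rewrite (negPf p1); apply/esym/negbTE/q_in2.
rewrite z2 andbT wb1 // wb2 //; split=> //.
case z1: (val z \in t.1); rewrite ?orbF // orbT; apply/esym.
by apply: hQ; [exact: zp|case: (tbag _ z1 z2 (zp z))].
Qed.

(** On [s.2 :&: t.2] the two torsos have the same edges. A neighbour of [q] in [t.2] is in the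
    separator of [t], and a neighbour of [p] in [s.2] is in the separator of [s]. Hence either extra
    vertex is joined exactly to the common vertices that lie in one of the two separators. *)
Lemma leaf_edge_swap s t p q sigma1 sigma2 (x y : torso_vtx sigma2) (x' y' : torso_vtx sigma1) :
  oo s -> oo t -> leaf_cross s t p q ->
  leaf_star s t p q sigma1 -> leaf_star t s q p sigma2 ->
  val x' = tperm p q (val x) -> val y' = tperm p q (val y) ->
  torso_rel (@oe G) sigma1 x' y' = torso_rel (@oe G) sigma2 x y.
Proof.
move=> Os Ot [ps1 ps2 pt1 pt2 qt1 qt2 qs1 qs2 only] [st1 sO1 b1 e1] [st2 sO2 b2 e2] xE yE.
have [Ss St] := (or_sep ok Os, or_sep ok Ot).
have xy : (x' == y') = (x == y) by rewrite -!val_eqE xE yE (inj_eq perm_inj).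
rewrite e1 e2 xy xE yE; have [//|nxy] := eqVneq x y; rewrite /=.
have bP (z : torso_vtx sigma2) : val z != p -> [/\ val z \in s.2, val z \in t.2 & val z != q].
  move=> zp; have := valP z; rewrite /= b2 (negPf zp) orbF => /andP[zt ->]; split=> //.
  by apply: contraNneq qt2 => <-.
have sE z : z \in s.2 -> (z \in separator s) = (z \in s.1) by rewrite inE => ->; rewrite andbT.
have tE z : z \in t.2 -> (z \in separator t) = (z \in t.1) by rewrite inE => ->; rewrite andbT.
have pt : p \in separator t by rewrite inE pt1.
have qs : q \in separator s by rewrite inE qs1.
have tD (z : torso_vtx sigma2) : val z != p -> val z != q -> tperm p q (val z) = val z.
  by move=> zp zq; rewrite tpermD // eq_sym.
have main (w : torso_vtx sigma2) : val w != p ->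
   [|| oe q (val w), val w \in separator s | val w \in separator t] =
   [|| oe p (val w), val w \in separator t | val w \in separator s].
  move=> wp; have [ws wt wq] := bP w wp.
  rewrite sE // tE //.
  have h1 : oe q (val w) -> val w \in t.1 by move/(sep_nbr St)/(_ qt2).
  have h2 : oe p (val w) -> val w \in s.1 by move/(sep_nbr Ss)/(_ ps2).
  case: (oe q _) h1 => [/(_ isT)->|_]; case: (oe p _) h2 => [/(_ isT)->|_] //=;
    rewrite ?orbT //; exact: orbC.
have [xp|xp] := eqVneq (val x) p; have [yp|yp] := eqVneq (val y) p.
- by case/negP: nxy; rewrite -val_eqE xp yp.
- have [_ _ yq] := bP y yp; rewrite xp tpermL tD // pt qs eqxx (negPf yq) /=.
  exact: main yp.
- have [_ _ xq] := bP x xp; rewrite yp tpermL tD // pt qs eqxx (negPf xq) /= !andbT.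
  by rewrite ![oe (sval x) _](or_sym ok); apply: main.
- have [_ _ xq] := bP x xp; have [_ _ yq] := bP y yp.
  rewrite !tD // (negPf xq) (negPf yq) /=.
  by congr (_ || _); apply: orbC.
Qed.

Lemma leaf_swap s t p q sigma1 sigma2 : oo s -> oo t -> leaf_cross s t p q ->
  leaf_star s t p q sigma1 -> leaf_star t s q p sigma2 ->
  og_iso (torso_og sigma1) (torso_og sigma2).
Proof.
move=> Os Ot lc l1 l2; have lc' := leaf_crossC lc.
have fb (x : torso_vtx sigma2) : tperm p q (val x) \in bag sigma1.
  by apply: leaf_bag_swap lc l1 l2 (valP x).
have gb (x : torso_vtx sigma1) : tperm q p (val x) \in bag sigma2.
  by apply: leaf_bag_swap lc' l2 l1 (valP x).
pose f (x : torso_vtx sigma2) : torso_vtx sigma1 := Sub (tperm p q (val x)) (fb x).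
pose g (x : torso_vtx sigma1) : torso_vtx sigma2 := Sub (tperm q p (val x)) (gb x).
have fK : cancel f g by move=> x; apply: val_inj; rewrite /= tpermC tpermK.
have gK : cancel g f by move=> x; apply: val_inj; rewrite /= tpermC tpermK.
have bf : bijective f by exists g.
have fe x y : torso_rel (@oe G) sigma1 (f x) (f y) = torso_rel (@oe G) sigma2 x y.
  exact: leaf_edge_swap Os Ot lc l1 l2 _ _.
exists f; split=> // s'; split=> Os'.
  split; first by apply: proper3_iso (proj1 Os').
  have [w Ow h] := leaf_restrict Os Ot lc l1 Os'; exists w => //.
  congr pair; apply/setP=> x; rewrite !inE; have [h1 h2] := h (f x).
    by rewrite -h1 /= tpermK.
  by rewrite -h2 /= tpermK.
have E : preim_sep g (preim_sep f s') = s' by apply: preim_sep_can.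
have bg : bijective g by exists f.
split.
  rewrite -E; apply: proper3_iso (proj1 Os') => // x y.
  by rewrite -fe !gK.
have [w Ow h] := leaf_restrict Ot Os lc' l2 Os'; exists w => //.
rewrite -[RHS]E; congr pair; apply/setP=> x; rewrite [LHS]inE [RHS]inE; have [h1 h2] := h (g x).
  by rewrite -h1 /= tpermK.
by rewrite -h2 /= tpermK.
Qed.

End LeafSwap.

Lemma diamond (G : ograph) (s t : osep G) : og_ok G -> oo s -> oo t ->
  thick (@oe G) s -> thick (@oe G) t ->
  exists H K, [/\ reduces_eq (torso_og [set s]) H, reduces_eq (torso_og [set t]) K & og_iso H K].
Proof.
move=> ok Os Ot ths tht.
have [cj|cj] := leqP #|separator (join s t)| 3.
  have Oj := or_join ok Os Ot cj.
  (* Extending the star of [v] by a separation above [v] drops [v], so both branches end in the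
     torso of the join. *)
  have ext v : oo v -> sle v (join s t) -> reduces_eq (torso_og [set v]) (torso_og [set join s t]).
    move=> Ov lv; suff <- : star_extend [set v] (join s t) = [set join s t].
      apply: extend_reduces; [done|exact: star1|exact: or_set1|done|by move=> u /set1P->; left|left].
      by exists v; rewrite ?set11.
    apply/setP=> u; rewrite !inE; case: (u == join s t) => //=.
    by apply/negP=> /andP[/eqP->]; rewrite lv.
  exists (torso_og [set join s t]), (torso_og [set join s t]); split.
  - by apply: ext; rewrite // /sle /= subsetUl subsetIl.
  - by apply: ext; rewrite // /sle /= subsetUr subsetIr.
  - exact: og_iso_refl.
have [dj|[p [q lc]]] := crossing ok Os Ot cj; last first.
  have [sigma1 l1 r1] := leaf_star_exists ok Os Ot tht lc.
  have [sigma2 l2 r2] := leaf_star_exists ok Ot Os ths (leaf_crossC lc).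
  exists (torso_og sigma1), (torso_og sigma2); split=> //.
  exact: leaf_swap Os Ot lc l1 l2.
have dj' : sle t (flip s) by case/andP: dj => h1 h2; apply/andP.
have ext u v : oo u -> oo v -> sle u (flip v) -> thick (@oe G) v ->
    reduces_eq (torso_og [set u]) (torso_og [set v; u]).
  move=> Ou Ov uv th; suff <- : star_extend [set u] v = [set v; u].
    apply: extend_reduces; [done|exact: star1|exact: or_set1|done|by move=> w /set1P->; right|].
    by right; left.
  apply/setP=> w; rewrite !inE; case: (w == v) => //=; case: eqP => //= ->.
  apply/negP=> /andP[_ /subsetP h]; have [x xu] := or_int1 ok Ou.
  have := sep_cover x (or_sep ok Ov); case/andP: uv => _ /subsetP h'.
  by case/orP=> [/h'|/h]; rewrite (negPf xu).
exists (torso_og [set t; s]), (torso_og [set s; t]); split; [exact: ext|exact: ext|].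
by rewrite setUC; apply: og_iso_refl.
Qed.

(** * Cycles *)

Section Cycles.
Variables (T : finType) (e : rel T).
Hypotheses (e_sym : symmetric e) (e_irr : irreflexive e).
Implicit Types (s : osep T) (S : {set T}).

(** A path is grown at its head, which has a neighbour in [S] other than its predecessor; this
    neighbour is new or closes a cycle with an initial piece of the path. *)
Lemma min_degree2_path S x0 : x0 \in S -> (forall v, v \in S -> 1 < #|nb e v :&: S|) ->
  forall k, has_cycle e S \/
    exists x p, [/\ uniq (x :: p), all (fun v => v \in S) (x :: p), path e x p & size p = k].
Proof.
move=> x0S deg; elim=> [|k [|[x [p [u a pth sz]]]]]; [|by left|].
  by right; exists x0, [::]; rewrite /= x0S.
have xS : x \in S by case/andP: a.
(* The default [x] stands for a missing predecessor when [p] is empty; it is no neighbour of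
   itself. *)
have [y] : exists y, y \in (nb e x :&: S) :\ head x p.
  apply/set0Pn; rewrite -card_gt0; have := deg x xS.
  by rewrite (cardsD1 (head x p)); case: (head x p \in nb e x :&: S) => /=; clear; lia.
rewrite !inE => /and3P[yh exy yS].
have [yp|yp] := boolP (y \in p); last first.
  right; exists y, (x :: p); split=> /=.
  - rewrite inE negb_or yp andbT; apply/andP; split=> //.
    by apply: contraTneq exy => ->; rewrite e_irr.
  - by rewrite yS.
  - by rewrite e_sym exy.
  - by rewrite sz.
left; case/splitPr: yp u a pth sz yh => p1 p2 u a pth sz yh.
have E : x :: p1 ++ y :: p2 = (x :: rcons p1 y) ++ p2 by rewrite /= cat_rcons.
exists (x :: rcons p1 y); split.
- by move: u; rewrite E cat_uniq => /andP[].
- by rewrite /= size_rcons; case: (p1) yh => //=; rewrite eqxx.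
- by move: a; rewrite E all_cat => /andP[].
- rewrite /= rcons_path last_rcons e_sym exy andbT.
  by move: pth; rewrite -cat_rcons cat_path => /andP[].
Qed.

Lemma acyclic_low_degree S : S != set0 -> ~ has_cycle e S ->
  exists2 v, v \in S & #|nb e v :&: S| <= 1.
Proof.
move=> /set0Pn[x0 x0S] nc.
have [/existsP[v /andP[]]|/existsPn h] := boolP [exists v in S, #|nb e v :&: S| <= 1].
  by exists v.
have [] // := min_degree2_path x0S _ #|T|.
  by move=> v vS; have := h v; rewrite vS /= -ltnNge.
case=> x [p [u _ _ sz]]; have := uniq_leq_size u (s2 := enum T).
by rewrite /= sz -cardT ltnn => /(_ (fun z _ => mem_enum T z)).
Qed.

Lemma has_cycle_sub S S' : S \subset S' -> has_cycle e S -> has_cycle e S'.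
Proof.
move=> /subsetP sub [l [u sz a c]]; exists l; split=> //.
by apply/allP=> x xl; apply: sub; apply: (allP a).
Qed.

(** Removing a vertex of degree at most 1 lowers the degree sum by at most 2. This is the bound on
    the number of edges of a forest, each edge being counted at both ends. *)
Lemma acyclic_edges S : S != set0 -> ~ has_cycle e S ->
  \sum_(v in S) #|nb e v :&: S| <= 2 * #|S|.-1.
Proof.
have [n] := ubnP #|S|; elim: n S => // n IHn S cS S0 nc.
have [v vS dv] := acyclic_low_degree S0 nc.
have cD : #|S| = #|S :\ v|.+1 by rewrite (cardsD1 v S) vS.
rewrite (big_setD1 v) //= cD /=.
have E : \sum_(u in S :\ v) #|nb e u :&: S| =
    \sum_(u in S :\ v) #|nb e u :&: (S :\ v)| + #|nb e v :&: S|.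
  have -> : #|nb e v :&: S| = \sum_(u in S :\ v) e v u.
    rewrite -sum1_card big_mkcond /= [RHS]big_mkcond /=; apply: eq_bigr => u _.
    rewrite !inE; have [->|_] := eqVneq u v; first by rewrite e_irr.
    by case: (e v u); case: (u \in S).
  rewrite -big_split /=; apply: eq_bigr => u _.
  rewrite (cardsD1 v) !inE vS andbT e_sym addnC; congr (_ + _); apply: eq_card => w.
  by rewrite !inE; case: (w == v); rewrite ?andbF.
rewrite E; have [S1|S1] := eqVneq (S :\ v) set0.
  rewrite S1 big_set0 cards0 muln0 leqn0 add0n; suff -> : nb e v :&: S = set0 by rewrite cards0.
  apply/setP=> u; rewrite !inE; apply/negbTE/negP=> /andP[evu uS].
  have : u \in S :\ v by rewrite !inE uS andbT; apply: contraTneq evu => ->; rewrite e_irr.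
  by rewrite S1 inE.
have := IHn (S :\ v); rewrite cD ltnS in cS => /(_ cS S1).
have nc' : ~ has_cycle e (S :\ v) by move=> /(has_cycle_sub (subsetDl _ _)).
move=> /(_ nc'); have : 0 < #|S :\ v| by rewrite card_gt0.
by move: dv; clear; lia.
Qed.

(** With i strict vertices, a forest on the i+3 vertices of the first side has degree sum at most
    2i+4. Strict vertices contribute at least 3 and separator vertices at least 1, which gives 3i+3
    and is too much for i at least 2. An edge inside the separator raises its two ends to degree at
    least 2 and gives 3i+5, always too much. *)
Lemma thick_cycle s : k_connected e 3 -> proper3 e s -> thick e s -> has_cycle e s.1.
Proof.
move=> G3 P th; apply: NNPP => nc; have [S [x0 x0P] _ c] := proj1 (proper3P _ _) P.
have ne : s.1 != set0 by apply/set0Pn; exists x0; apply: sep_in1 S x0P.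
have := acyclic_edges ne nc; rewrite leqNgt => /negP[].
rewrite -(cardsID s.2 s.1) -[s.1 :&: s.2]/(separator s) c (big_setID s.2) /=.
rewrite -[s.1 :&: s.2]/(separator s).
pose i := #|s.1 :\: s.2|.
have lI : 3 * i <= \sum_(v in s.1 :\: s.2) #|nb e v :&: s.1|.
  rewrite mulnC -sum_nat_const; apply: leq_sum => v /setDP[_ v2].
  apply: leq_trans (degree_ge3 e_irr G3 v) _; apply/subset_leq_card/subsetP=> w.
  by rewrite !inE => evw; rewrite evw (sep_nbr S evw v2).
have nb1 v : v \in separator s -> exists2 w, w \in nb e v :&: s.1 & w \notin s.2.
  move=> vs; have [w evw w2] := sep_vertex_nbr e_sym G3 P vs.
  by exists w => //; rewrite !inE evw (sep_in1 S w2).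
have l1 v : v \in separator s -> 1 <= #|nb e v :&: s.1|.
  by move=> /nb1[w ws _]; apply/card_gt0P; exists w.
case: th => [c1|[x [y [xs ys exy]]]].
  have lS : 3 <= \sum_(v in separator s) #|nb e v :&: s.1|.
    by rewrite -c -sum1_card; apply: leq_sum => v /l1.
  by move: lI lS c1; rewrite -/i; clear; lia.
have xy : x != y by apply: contraTneq exy => ->; rewrite e_irr.
have l2 v w : v \in separator s -> w \in separator s -> e v w -> 2 <= #|nb e v :&: s.1|.
  move=> vs ws evw; have [z zs z2] := nb1 v vs.
  have <- : #|[set w; z]| = 2.
    rewrite cards2; suff -> : w != z by [].
    by apply: contraNneq z2 => <-; move: ws; rewrite inE => /andP[].
  apply/subset_leq_card/subsetP=> r /set2P[]-> //; rewrite !inE evw.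
  by move: ws; rewrite inE => /andP[].
have lS : 5 <= \sum_(v in separator s) #|nb e v :&: s.1|.
  have yx : y \in separator s :\ x by rewrite !inE eq_sym xy -in_setI.
  rewrite (big_setD1 x) //= (big_setD1 y) //=.
  have lx := l2 x y xs ys exy.
  have ly : 2 <= #|nb e y :&: s.1| by apply: (l2 y x) => //; rewrite e_sym.
  have lr : 1 <= \sum_(v in separator s :\ x :\ y) #|nb e v :&: s.1|.
    have <- : #|separator s :\ x :\ y| = 1.
      by move: c; rewrite (cardsD1 x) xs (cardsD1 y) yx; clear; lia.
    by rewrite -sum1_card; apply: leq_sum => v /setD1P[_ /setD1P[_ /l1]].
  by move: lx ly lr; clear; lia.
by move: lI lS; rewrite -/i; clear; lia.
Qed.

(** With at most one strict vertex and no edge inside the separator, all edges of the first side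
    share that vertex, so they cannot form a cycle. *)
Lemma cycle_thick s : separation e s -> has_cycle e s.1 -> thick e s.
Proof.
move=> S [l [u sz a c]]; have [|c1] := ltnP 1 #|s.1 :\: s.2|; [by left|right].
apply: NNPP => nt.
have ed x y : x \in s.1 -> y \in s.1 -> e x y -> (x \notin s.2) || (y \notin s.2).
  move=> x1 y1 exy; rewrite -negb_and; apply/negP=> /andP[x2 y2]; apply: nt.
  by exists x, y; rewrite !inE x1 y1 x2 y2.
have int1 x y : x \in s.1 -> y \in s.1 -> x \notin s.2 -> y \notin s.2 -> x = y.
  move=> x1 y1 x2 y2; apply/eqP; move: c1; apply: contraTT => xy; rewrite -ltnNge.
  apply: leq_trans (subset_leq_card (A := [set x; y]) _); first by rewrite cards2 xy.
  by apply/subsetP=> z /set2P[]->; rewrite inE ?x2 ?y2.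
case: l u sz a c => [|x [|y [|z l]]] // u _ a c.
(* [w] follows [z] on the cycle; it is [x] when the cycle is a triangle. The strict vertex has to be
   [y], and then the edge from [z] to [w] misses it. *)
have [w [ws wx ezw wy]] : exists w, [/\ w \in s.1, w != z, e z w & w != y].
  case: l u a c => [|w l] /=; rewrite ?inE ?negb_or ?andbT => u a c.
    case/andP: u => /andP[xy xz] _; case/and3P: a => x1 _ _; case/and3P: c => _ _ ezx.
    by exists x.
  case/and3P: u => _ /and3P[_ yw _] /andP[/andP[zw _] _].
  case/and5P: a => _ _ _ w1 _; case/and4P: c => _ _ ezw _.
  by exists w; rewrite ![w == _]eq_sym.
move: u a c => /= /and4P[]; rewrite !inE !negb_or => /and3P[xy xz _] /andP[yz _] _ _.
move=> /and4P[x1 y1 z1 _] /and3P[exy eyz _].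
have y2 : y \notin s.2.
  apply: contraNN xz => y2; have := ed _ _ x1 y1 exy; have := ed _ _ y1 z1 eyz.
  by rewrite y2 orbF /= => z2 x2; apply/eqP/int1.
case/orP: (ed _ _ z1 ws ezw) => h2.
  by rewrite (int1 _ _ y1 z1) ?eqxx in yz.
by rewrite (int1 _ _ y1 ws) ?eqxx in wy.
Qed.

End Cycles.

(** * Tangles *)

Lemma reaches_rcons G H K : reaches G H -> reduces_eq H K -> reaches G K.
Proof.
elim=> [{}G {}H i|{}G H' {}H r _ IH] rK; last by apply: reaches_step r (IH rK).
case: rK => _ [r|j]; last by apply: reaches_iso; apply: og_iso_trans i j.
apply: reaches_step (iso_reduces (og_iso_sym i) r) _.
exact/reaches_iso/og_iso_refl.
Qed.

Section Sle.
Variable T : finType.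
Implicit Types s t u : osep T.

Lemma sle_trans s t u : sle s t -> sle t u -> sle s u.
Proof.
move=> /andP[a b] /andP[c d]; apply/andP; split; first exact: subset_trans a c.
exact: subset_trans d b.
Qed.

Lemma sle_anti s t : sle s t -> sle t s -> s = t.
Proof.
case: s => a b; case: t => c d /andP[/= h1 h2] /andP[/= h3 h4].
by congr pair; apply/eqP; rewrite eqEsubset ?h1 ?h2 ?h3 ?h4.
Qed.

Lemma sle_flip s t : sle (flip s) (flip t) = sle t s.
Proof. by rewrite /sle andbC. Qed.

Definition nested s t := [|| sle s t, sle s (flip t), sle (flip s) t | sle (flip s) (flip t)].

Lemma nestedC s t : nested s t = nested t s.
Proof.
rewrite /nested !sle_flip -(sle_flip s (flip t)) -(sle_flip (flip s) t) !flipK.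
by do 4!case: (sle _ _).
Qed.

Lemma nested_flip s t : nested (flip s) t = nested s t.
Proof. by rewrite /nested flipK; do 4!case: (sle _ _). Qed.

End Sle.

Section Tangle.
Variables (T : finType) (e : rel T) (tau : {set osep T}).
Hypotheses (e_sym : symmetric e) (e_irr : irreflexive e) (G3 : k_connected e 3).
Hypotheses (Htau : tangle e 4 tau) (Hnc : ~ cubic_tangle e tau).
Implicit Types s t u : osep T.

Lemma tangle_cover s1 s2 s3 : s1 \in tau -> s2 \in tau -> s3 \in tau ->
  ~ covers3 e s1.1 s2.1 s3.1.
Proof. by case: Htau => _ _; apply. Qed.

Lemma tangle_nfull s : s \in tau -> s.1 != setT.
Proof.
move=> st; apply/eqP=> E; apply: (tangle_cover st st st).
by rewrite E; split=> [v|x y _]; rewrite !inE.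
Qed.

(** The other orientation would have the whole graph as its small side. *)
Lemma tangle_small (Y : {set T}) : #|Y| <= 3 -> (Y, setT) \in tau.
Proof.
move=> cY; case: Htau => _ h _; have [||/orP[//|fl] _] := h (Y, setT).
- by apply/separationP; split=> [x|x y _]; rewrite !inE ?orbT.
- by rewrite /sorder /separator setIT.
- by have := tangle_nfull fl; rewrite /= eqxx.
Qed.

Definition tangle_or s : Prop := s \in tau /\ proper3 e s.

Lemma tangle_oriented : oriented e tangle_or.
Proof.
have [t1 t2 _] := Htau; split=> //.
- by move=> s [].
- move=> s P; have [S _ _ c] := proj1 (proper3P _ _) P.
  have [|/orP[ss|sf] _] := t2 s S; first by rewrite /sorder c.
    by left.
  by right; split=> //; apply: proper3_flip.
- move=> s [ss P] [sf _]; have [S [x xs] _ c] := proj1 (proper3P _ _) P.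
  have [|_] := t2 s S; first by rewrite /sorder c.
  rewrite ss sf => /(_ isT) E; case/negP: (xs); rewrite -E; exact: sep_in1 S xs.
- move=> s t [ss P] [ts P'] c; have [S [x xs] _ _] := proj1 (proper3P _ _) P.
  have [S' _ _ _] := proj1 (proper3P _ _) P'.
  have Sj := separation_join S S'.
  (* With the other orientation, [s.1], [t.1] and [s.2 :&: t.2] would be three small sides covering
     all vertices and edges. *)
  have jt : join s t \in tau.
    have [|/orP[//|jf] _] := t2 _ Sj; first by rewrite /sorder ltnS.
    case: (tangle_cover ss ts jf); split=> [v|a b eab] /=; rewrite !inE.
      by move: (sep_cover v S) (sep_cover v S'); do ?[case: (_ \in _)].
    have sE (w : osep T) : separation e w -> (a \in w.1) && (b \in w.1) || (a \in w.2) && (b \in w.2).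
      move=> Sw; have [a1|a1] := boolP (a \in w.1); have [b1|b1] := boolP (b \in w.1) => //=.
      - by rewrite (sep_nbr2 e_sym Sw _ b1) 1?e_sym // (sep_in2 Sw b1).
      - by rewrite (sep_nbr2 e_sym Sw eab a1) (sep_in2 Sw a1).
      - by rewrite (sep_in2 Sw a1) (sep_in2 Sw b1).
    by case/orP: (sE s S) => [->//|/andP[-> ->]]; case/orP: (sE t S') => [->|/andP[-> ->]]; rewrite !orbT.
  have [y yj] : exists y, y \notin (join s t).1.
    by have := tangle_nfull jt; rewrite -subTset => /subsetPn[y _]; exists y.
  split=> //; apply: (proper3I G3 (x := x) (y := y)) => //.
  by rewrite inE negb_and xs.
Qed.

(** If [v] were the only vertex strictly on the second side, the graph would be covered by the first
    side, by [v] with two separator vertices, and by [v] with the third. Consequently the side to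
    which the tangle points is always thick. *)
Lemma tangle_big_side s : tangle_or s -> 1 < #|s.2 :\: s.1|.
Proof.
move=> [ss P]; have [S _ [v v1] c] := proj1 (proper3P _ _) P.
rewrite ltnNge; apply/negP => c1.
have v2 := sep_in2 S v1.
have Iv x : x \notin s.1 -> x = v.
  move=> x1; apply/eqP; move: c1; apply: contraTT => xv; rewrite -ltnNge.
  apply: leq_trans (subset_leq_card (A := [set x; v]) _); first by rewrite cards2 xv.
  by apply/subsetP=> z /set2P[]->; rewrite inE ?x1 ?v1 ?v2 ?(sep_in2 S x1).
have [z zs] : exists z, z \in separator s by apply/card_gt0P; rewrite c.
have tY : (v |: separator s :\ z, setT) \in tau.
  apply: tangle_small; rewrite -c (cardsD1 z (separator s)) zs cardsU1.
  by case: (_ \notin _).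
have tZ : ([set v; z], setT) \in tau.
  by apply: tangle_small; rewrite cards2; case: (_ != _).
apply: (tangle_cover ss tY tZ); split=> [x|x y exy] /=.
  have [//|/Iv->] := boolP (x \in s.1); by rewrite !inE eqxx.
have nbv (w : T) : e v w -> ((v \in v |: separator s :\ z) && (w \in v |: separator s :\ z)) ||
    ((v \in [set v; z]) && (w \in [set v; z])).
  move=> evw; rewrite !inE eqxx /=; have [->|wv] := eqVneq w v; first by [].
  have w2 := sep_nbr2 e_sym S evw v1; rewrite w2 andbT /=.
  have [_|_] := eqVneq w z; first by rewrite orbT.
  rewrite /= orbF; apply: contraNT wv => w1; apply/eqP; exact: Iv.
have [x1|/Iv xv] := boolP (x \in s.1); have [y1|/Iv yv] := boolP (y \in s.1) => //.
- by rewrite yv /= andbC [X in _ || X]andbC; apply: nbv; rewrite e_sym -yv.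
- by rewrite xv /=; apply: nbv; rewrite -xv.
- by rewrite xv yv e_irr in exy.
Qed.

Definition tangle_og : ograph := OGraph e tangle_or.

(** * Bags of non-cubic tangles *)

Section Bag.
Variable sigma : {set osep T}.
Hypotheses (st : star sigma) (sO : forall s, s \in sigma -> tangle_or s).
Let W := tangle_oriented.
Let X := bag sigma.

Lemma sep_sub_bag s : s \in sigma -> separator s \subset X.
Proof. by move=> ss; apply/subsetP=> x; apply: separator_bag. Qed.

(** All star members with separator [Y] are merged into one element of the tangle, so that the
    covering argument of [bag4_seps] spends a single small side on each triple. *)
Lemma tangle_absorb (Y : {set T}) : #|Y| = 3 -> exists u, [/\ u \in tau, Y \subset u.1 &
  forall s, s \in sigma -> separator s = Y -> s.1 \subset u.1].
Proof.
move=> cY; have [/existsP[s0 /andP[s0s /eqP E0]]|/existsPn n] :=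
    boolP [exists s in sigma, separator s == Y]; last first.
  exists (Y, setT); split; [by apply: tangle_small; rewrite cY|exact: subxx|].
  by move=> s ss /eqP E; have := n s; rewrite ss E.
pose S := [set s in sigma | separator s == Y].
have [|s x|u [ut _] [/andP[/subsetP u1 _] /subsetP u2]] := absorb W (sigma := S) _ (sO s0s).
- by move=> s; rewrite inE => /andP[/sO].
- by rewrite inE => /andP[_ /eqP->]; rewrite -E0 inE => /andP[].
have Yu : Y \subset u.1.
  by apply/subsetP=> x; rewrite -E0 inE => /andP[/u1].
exists u; split=> // s ss E; apply/subsetP=> x x1.
have [x2|x2] := boolP (x \in s.2); first by apply: (subsetP Yu); rewrite -E inE x1.
have [t1 _ _] := Htau; have [Su _] := t1 _ ut; apply: sep_in1 Su _.
apply: contra x2 => /u2 /bagP; apply.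
by rewrite inE ss E eqxx.
Qed.

(** If [Y] were no separator of a member, the three other triples of the bag would account for all
    members, and their merged small sides would cover the graph: any two bag vertices avoid one of
    the three vertices of [Y] and so lie in a common triple. *)
Lemma bag4_seps (Y : {set T}) : #|X| = 4 -> Y \subset X -> #|Y| = 3 ->
  exists2 s, s \in sigma & separator s = Y.
Proof.
move=> cX YX cY; apply: NNPP => nY.
have c2 : 2 < #|Y| by rewrite cY.
have [y1 [y2 [y3 [/= uq Y1 Y2 Y3]]]] := card_ge3P c2.
have cD y : y \in Y -> #|X :\ y| = 3.
  by move=> yY; move: cX; rewrite (cardsD1 y) (subsetP YX _ yY) => -[].
have [u1 [t1 h1 g1]] := tangle_absorb (cD _ Y1).
have [u2 [t2 h2 g2]] := tangle_absorb (cD _ Y2).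
have [u3 [t3 h3 g3]] := tangle_absorb (cD _ Y3).
have YE : [set y1; y2; y3] = Y.
  apply/eqP; rewrite eqEcard cY; apply/andP; split.
    by apply/subsetP=> z; rewrite !inE => /orP[/orP[]|] /eqP->.
  move: uq; rewrite !inE negb_or andbT => /andP[/andP[n12 n13] n23].
  by rewrite setUC cardsU1 cards2 !inE n12 ![y3 == _]eq_sym negb_or n13 n23.
have gs s : s \in sigma -> [|| s.1 \subset u1.1, s.1 \subset u2.1 | s.1 \subset u3.1].
  move=> ss; have sX := sep_sub_bag ss; have cs : #|separator s| = 3 by apply: (or_order W (sO ss)).
  have /subsetPn[y yY ys] : ~~ (Y \subset separator s).
    apply/negP=> Ys; apply: nY; exists s => //; apply/eqP.
    by rewrite eq_sym eqEcard Ys cs cY.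
  have E : separator s = X :\ y.
    apply/eqP; rewrite eqEcard cD // cs andbT; apply/subsetP=> z zs.
    by rewrite !inE (subsetP sX _ zs) andbT; apply: contraNneq ys => <-.
  move: yY; rewrite -YE !inE => /orP[/orP[]|] /eqP yE; rewrite yE in E.
  - by rewrite g1.
  - by rewrite g2 ?orbT.
  - by rewrite g3 ?orbT.
apply: (tangle_cover t1 t2 t3).
have big s z : s \in sigma -> z \in s.1 -> [|| z \in u1.1, z \in u2.1 | z \in u3.1].
  by move=> ss zs; case/or3P: (gs s ss) => /subsetP/(_ _ zs)->; rewrite ?orbT.
have big2 s z w : s \in sigma -> z \in s.1 -> w \in s.1 ->
    [|| (z \in u1.1) && (w \in u1.1), (z \in u2.1) && (w \in u2.1) | (z \in u3.1) && (w \in u3.1)].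
  by move=> ss zs ws; case/or3P: (gs s ss) => /subsetP h; rewrite !h ?orbT.
have inX z w : z \in X -> w \in X -> exists i, [/\ i \in [:: y1; y2; y3], z != i & w != i].
  move=> zX wX; move: uq; rewrite !inE negb_or andbT => /andP[/andP[n12 n13] n23].
  have [z1|z1] := eqVneq z y1; have [w1|w1] := eqVneq w y1; last by exists y1; rewrite !inE eqxx.
  - by exists y2; rewrite !inE eqxx z1 w1 n12 orbT.
  - have [w2|w2] := eqVneq w y2; last by exists y2; rewrite !inE eqxx z1 n12 w2 orbT.
    by exists y3; rewrite !inE eqxx z1 w2 n13 n23 !orbT.
  - have [z2|z2] := eqVneq z y2; last by exists y2; rewrite !inE eqxx w1 n12 z2 orbT.
    by exists y3; rewrite !inE eqxx z2 w1 n13 n23 !orbT.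
have inX2 z w : z \in X -> w \in X ->
    [|| (z \in u1.1) && (w \in u1.1), (z \in u2.1) && (w \in u2.1) | (z \in u3.1) && (w \in u3.1)].
  move=> zX wX; have [i [i3 zi wi]] := inX z w zX wX.
  have zD : z \in X :\ i by rewrite !inE zi.
  have wD : w \in X :\ i by rewrite !inE wi.
  move: i3; rewrite !inE => /or3P[] /eqP iE; rewrite {}iE in zD wD.
  - by rewrite !(subsetP h1).
  - by rewrite !(subsetP h2) ?orbT.
  - by rewrite !(subsetP h3) ?orbT.
split=> [z|z w ezw].
  have [zX|/notbag[s ss zs]] := boolP (z \in X).
    by have := inX2 z z zX zX; rewrite !andbb.
  by apply: (big s) => //; exact: (sep_in1 (or_sep W (sO ss)) zs).
have [zX|/notbag[s ss zs]] := boolP (z \in X); last first.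
  have Ss := or_sep W (sO ss).
  by apply: (big2 s _ _ ss); [exact: (sep_in1 Ss zs)|exact: (sep_nbr Ss ezw zs)].
have [wX|/notbag[s ss ws]] := boolP (w \in X); first exact: inX2.
have Ss := or_sep W (sO ss).
apply: (big2 s _ _ ss); last exact: (sep_in1 Ss ws).
by apply: (sep_nbr Ss _ ws); rewrite e_sym.
Qed.

(** The component stays strictly inside [s], so its neighbourhood is contained in the separator; a
    neighbourhood of fewer than three vertices would cut it off from some bag vertex. *)
Lemma nbhd_component s (v : T) : #|X| = 4 -> s \in sigma -> v \notin s.2 ->
  nbhd e (component e X v) = separator s.
Proof.
move=> cX ss vs; have Ss := or_sep W (sO ss).
have Xs2 z : z \in X -> z \in s.2 by move=> /bagP; apply.
have vX : v \notin X by apply: contra vs => /Xs2.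
have compS z : z \in component e X v -> z \notin s.2.
  rewrite inE => /andP[_ c]; apply: (connect_invariant (P := fun z => z \notin s.2) _ c) vs.
  move=> a b as2 /and3P[eab _ bX]; have b1 := sep_nbr Ss eab as2.
  by apply: contra bX => b2; apply: separator_bag ss _ => //; rewrite inE b1.
have sub : nbhd e (component e X v) \subset separator s.
  apply/subsetP=> y; rewrite inE => /andP[yC /existsP[x /andP[xC exy]]].
  have yX : y \in X.
    apply: contraR yC => yX; move: xC; rewrite !inE yX /= => /andP[xX cx].
    have xy : rel_minus e X x y by apply/and3P.
    exact: (connect_trans cx (connect1 xy)).
  by rewrite inE (Xs2 _ yX) andbT; apply: sep_nbr Ss exy (compS _ xC).
apply/eqP; rewrite eqEcard sub (or_order W (sO ss)) /= ltnNge; apply/negP=> c2.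
have [w wX wn] : exists2 w, w \in X & w \notin nbhd e (component e X v).
  apply/subsetPn/negP=> /subset_leq_card; rewrite cX => h.
  by have := leq_trans h c2.
have vC : v \in component e X v by rewrite inE vX connect0.
have : w \in component e X v.
  apply: (small_cut G3 (X := nbhd e (component e X v)) (x := v)) => //.
    move=> a b aC eab bn; apply: contraR bn => bC; rewrite inE bC.
    by apply/existsP; exists a; rewrite aC.
  by rewrite inE vC.
by rewrite inE wX.
Qed.

(** The torso is 3-connected and so has at least four vertices. If there were exactly four, the
    separators of members would be precisely the triples of the bag and the neighbourhoods of the
    components outside it, and the star would show the tangle to be cubic. *)
Lemma tangle_bag_gt4 : 4 < #|bag sigma|.
Proof.
have [c3 _] := torso_connected W st sO; rewrite card_sig in c3.
have {}c3 : 3 < #|bag sigma| by [].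
rewrite ltn_neqAle c3 andbT; apply/eqP=> c4; apply: Hnc; exists sigma; split=> //.
- by apply/subsetP=> s /sO[].
- by move=> s /sO Os; split; [exact: (or_sep W Os)|exact: (or_order W Os)].
split=> //; apply/setP=> Y; apply/imsetP/idP=> [[v vX ->]|].
  move/setCP/negP/notbag: vX => [s ss vs].
  by rewrite inE (nbhd_component (esym c4) ss vs) sep_sub_bag //= (or_order W (sO ss)).
rewrite inE => /andP[YX /eqP cY]; have [s ss E] := bag4_seps (esym c4) YX cY.
have [v vs] := or_int1 W (sO ss); exists v; last by rewrite (nbhd_component (esym c4) ss vs).
by rewrite inE; apply: contra vs => /bagP; apply.
Qed.

End Bag.

End Tangle.

(** * Maximal 3-chops *)

Section Chops.
Variables (T : finType) (e : rel T) (tau : {set osep T}).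
Hypotheses (e_sym : symmetric e) (e_irr : irreflexive e) (G3 : k_connected e 3).
Hypotheses (Htau : tangle e 4 tau) (Hnc : ~ cubic_tangle e tau).
Implicit Types s t u v : osep T.
Notation O := (tangle_or e tau).
Let W : oriented e O := tangle_oriented e_sym e_irr G3 Htau.
Let og := tangle_og e tau.

Lemma og_okT : og_ok og. Proof. exact: W. Qed.

Section Chop.
Variable N : {set osep T}.
Hypothesis chopN : chop3 e N.

Lemma chop_nested s t : s \in N -> t \in N -> nested s t.
Proof. by case: chopN => _ _ nN _; apply: nN. Qed.

Lemma chop_orient s : s \in N -> exists2 u, u \in N /\ O u & u = s \/ u = flip s.
Proof.
move=> sN; have [sym P _ _] := chopN.
case: (or_total W (P s sN)) => Os; first by exists s => //; left.
by exists (flip s) => //; [split=> //; apply: sym|right].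
Qed.

(** The enumeration is processed with a star lying above everything treated so far. A separation
    below a member changes nothing; any other one extends the star and yields a step or an
    isomorphism. *)
Lemma chop_reaches : exists sigma, [/\ star sigma,
    forall s, s \in sigma -> s \in N /\ O s,
    reaches (@torso_og og set0) (@torso_og og sigma) &
    forall s, s \in N -> exists2 t, t \in sigma & sle s t || sle (flip s) t].
Proof.
have [sym P nN [l [lN Nl cl]]] := chopN.
suff [sigma [st sN r cov]] : exists sigma, [/\ star sigma,
    forall s, s \in sigma -> s \in N /\ O s,
    reaches (@torso_og og set0) (@torso_og og sigma) &
    forall i, i < size l -> exists2 t, t \in sigma &
      sle (nth (setT, setT) l i) t || sle (flip (nth (setT, setT) l i)) t].
  exists sigma; split=> // s /lN /orP[sl|sl].
    by have := cov (index s l); rewrite index_mem nth_index // => /(_ sl).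
  have := cov (index (flip s) l); rewrite index_mem nth_index // => /(_ sl)[t ts].
  by rewrite flipK orbC; exists t.
have: forall k, k <= size l -> exists sigma, [/\ star sigma,
    forall s, s \in sigma -> s \in N /\ O s,
    reaches (@torso_og og set0) (@torso_og og sigma) &
    forall i, i < k -> exists2 t, t \in sigma &
      sle (nth (setT, setT) l i) t || sle (flip (nth (setT, setT) l i)) t].
  elim=> [_|k IHk kl].
    (* The bag of the empty star is the whole vertex set, so its torso is a copy of the graph. *)
    exists set0; split=> //.
    - by move=> s t; rewrite inE.
    - by move=> s; rewrite inE.
    - exact/reaches_iso/og_iso_refl.
  have [sigma [st sN r cov]] := IHk (ltnW kl).
  have nN0 := Nl _ (mem_nth (setT, setT) kl).
  set s0 := nth _ l k in nN0.
  have [u [uN Ou] us] := chop_orient nN0.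
  have sepu : separator u = separator s0 by case: us => ->; rewrite ?separator_flip.
  have covu (sigma' : {set osep T}) : (exists2 t, t \in sigma' & sle u t) ->
      (forall i, i < k -> exists2 t, t \in sigma' &
        sle (nth (setT, setT) l i) t || sle (flip (nth (setT, setT) l i)) t) ->
      forall i, i < k.+1 -> exists2 t, t \in sigma' &
        sle (nth (setT, setT) l i) t || sle (flip (nth (setT, setT) l i)) t.
    move=> [t ts ut] h i; rewrite ltnS leq_eqVlt => /orP[/eqP->|]; last exact: h.
    by exists t => //; rewrite -/s0; case: us => <-; rewrite ut ?orbT.
  have [/existsP[t /andP[ts ut]]|/existsPn nu] := boolP [exists t in sigma, sle u t].
    by exists sigma; split=> //; apply: covu => //; exists t.
  have sO s : s \in sigma -> O s by case/sN.
  (* Of the four ways to be nested, the orientation excludes [flip s] below [u], and by assumption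
     [u] is below no member. *)
  have su s : s \in sigma -> sle s u \/ sle s (flip u).
    move=> ss; have [sN' Os] := sN s ss; have := chop_nested sN' uN.
    case/or4P; [by left|by right|by move/(or_nocover W Os Ou)|].
    by rewrite sle_flip => h; have := nu s; rewrite ss h.
  exists (@star_extend og sigma u); split.
  - exact: (star_extend_star (G := og) st su).
  - by move=> s /(star_extendP (G := og) su)[->|[/sN]].
  - apply: reaches_rcons r _; apply: (extend_reduces og_okT) => //.
    have [[_ [cy1 cy2]]|[j [jk c2]]] := cl k kl.
      (* Both sides contain a cycle, so either orientation is thick. *)
      right; left; apply: (cycle_thick (or_sep W Ou)).
      by case: us => ->.
    (* The earlier separation is below a member [t] in one of its orientations. The shared vertices
       are in the bag, being separator vertices of [u], and in [t.1], hence in the separator of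
       [t]. *)
    right; right; have [t ts jt] := cov j jk.
    have [x [y [xI yI xy]]] : exists x y, [/\ x \in separator s0 :&: separator (nth (setT, setT) l j),
        y \in separator s0 :&: separator (nth (setT, setT) l j) & x != y].
      have /card_gt0P[x xI] : 0 < #|separator s0 :&: separator (nth (setT, setT) l j)|.
        exact: leq_trans c2.
      rewrite (cardsD1 x) xI in c2; have /card_gt0P[y] := c2.
      by rewrite in_setD1 => /andP[yx yI]; exists x, y; rewrite eq_sym.
    have inT z : z \in separator s0 :&: separator (nth (setT, setT) l j) ->
        z \in separator u /\ z \in separator t.
      rewrite in_setI -sepu => /andP[zu zj]; split=> //.
      apply: (bag_separator ts); last exact: (subsetP (sep_extend_bag (G := og) su)).
      move: zj; rewrite inE => /andP[z1 z2].
      by case/orP: jt => /andP[/subsetP h _]; apply: h.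
    have [[xu xt] [yu yt]] := (inT x xI, inT y yI).
    by exists t, x, y; rewrite xt yt.
  - apply: covu => [|i ik].
      exists u; last by rewrite /sle !subxx.
      by apply/(star_extendP (G := og) su); left.
    have [t ts it] := cov i ik; have [tu|tu] := boolP (sle t u).
      exists u; first by apply/(star_extendP (G := og) su); left.
      by case/orP: it => h; rewrite (sle_trans h tu) ?orbT.
    by exists t; rewrite // !inE ts tu orbT.
by move/(_ (size l) (leqnn _)).
Qed.

(** Distinct members of one star are incomparable. A member [s] is below some [t] of the other star,
    which is below some [r] of the first; so [s = r], and both equal [t]. Applied both ways, this
    identifies the given splitting star with the constructed one. *)
Lemma splitting_star_sub (sigma sigma' : {set osep T}) :
  star sigma -> (forall s, s \in sigma -> s \in N /\ O s) ->
  (forall s, s \in N -> exists2 t, t \in sigma & sle s t || sle (flip s) t) ->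
  (forall s, s \in sigma' -> s \in N /\ O s) ->
  (forall s, s \in N -> exists2 t, t \in sigma' & sle s t || sle (flip s) t) ->
  sigma \subset sigma'.
Proof.
move=> st sN cov sN' cov'.
have le (rho : {set osep T}) s : O s -> (forall s, s \in rho -> s \in N /\ O s) ->
    (exists2 t, t \in rho & sle s t || sle (flip s) t) -> exists2 t, t \in rho & sle s t.
  move=> Os rN [t tr /orP[h|h]]; first by exists t.
  by case: (or_nocover W Os (proj2 (rN t tr)) h).
apply/subsetP=> s ss; have [sN0 Os] := sN s ss.
have [t ts' st'] := le sigma' s Os sN' (cov' s sN0).
have [tN Ot] := sN' t ts'.
have [r rs tr] := le sigma t Ot sN (cov t tN).
have sr := sle_trans st' tr.
have E : s = r.
  apply/eqP; apply: contraT => nsr; have [x x2] := or_int1 W Os.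
  have := sep_cover x (or_sep W (proj2 (sN r rs))).
  case/andP: sr => _ /subsetP h; have /andP[_ /subsetP h'] := st _ _ ss rs nsr.
  by case/orP=> [/h'|/h]; rewrite (negPf x2).
by rewrite -E in tr; rewrite (sle_anti st' tr).
Qed.

End Chop.

Section MaxChop.
Variables (N sigma : {set osep T}).
Hypotheses (maxN : max_chop3 e N) (spl : splitting_star N sigma) (sub : sigma \subset tau).
Let chopN : chop3 e N := proj1 maxN.

Lemma splitting_or s : s \in sigma -> s \in N /\ O s.
Proof.
case: spl => /subsetP sN _ _ ss; have [_ P _ _] := chopN.
by split; [exact: sN|split; [exact: (subsetP sub)|apply/P/sN]].
Qed.

Lemma splitting_sO s : s \in sigma -> O s.
Proof. by case/splitting_or. Qed.

Lemma splitting_star_star : star sigma. Proof. by case: spl. Qed.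

Lemma splitting_reaches : reaches (@torso_og og set0) (@torso_og og sigma).
Proof.
have [rho [st rN r cov]] := chop_reaches chopN; have [_ st' cov'] := spl.
suff -> : sigma = rho by [].
apply/eqP; rewrite eqEsubset (splitting_star_sub st' splitting_or cov' rN cov).
by rewrite (splitting_star_sub st rN cov splitting_or cov').
Qed.

(** A thick separation of the torso would lift to a separation [v] nested with [N] but not in [N],
    and [v] could be put at the end of the enumeration, against maximality. *)
Lemma splitting_thin (s' : osep (torso_vtx sigma)) : torso_or e O s' -> ~ thick (torso_rel e sigma) s'.
Proof.
move=> Os' th; have st := splitting_star_star; have sO := splitting_sO.
have tW := torso_oriented W st sO.
have [Ps' _] := Os'; have [S [x0 x0P] [y0 y0P] c] := proj1 (proper3P _ _) Ps'.
have [v [Sv Ev vb nst]] := torso_lift W st sO S.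
have x0v : val x0 \notin v.2 by move: x0P; rewrite -Ev inE.
have y0v : val y0 \notin v.1 by move: y0P; rewrite -Ev inE.
have cv : #|separator v| = 3 by rewrite -c -Ev torso_order.
have Pv : proper3 e v.
  by apply/proper3P; split=> //; [exists (val x0)|exists (val y0)].
have Ov : O v.
  case: (or_total W Pv) => // Of; case: (or_asym tW Os').
  split; first by apply: proper3_flip => //; apply: (torso_sym W).
  by exists (flip v); rewrite // -Ev.
have [sym P nN [l [lN Nl cl]]] := chopN.
(* Below a member [t], the three separator vertices of [v] and one further bag vertex would all lie
   in the separator of [t]. *)
have notle (u : osep T) (x : torso_vtx sigma) : val x \in u.1 -> val x \notin u.2 -> separator u = separator v ->
    forall t, t \in sigma -> ~~ sle u t.
  move=> x1 x2 E t ts; apply/negP=> /andP[/subsetP h _].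
  have: #|val x |: separator v| <= #|separator t|.
    apply/subset_leq_card/subsetP=> z /setU1P[->|zv].
      exact: (bag_separator ts (h _ x1) (valP x)).
    apply: (bag_separator ts); last exact: (subsetP vb).
    by apply: h; move: zv; rewrite -E inE => /andP[].
  by rewrite cardsU1 -{1}E inE (negPf x2) andbF cv (or_order W (sO t ts)).
have vN : v \notin N.
  apply/negP=> vN; have [_ _ cov] := spl; have [t ts /orP[]] := cov v vN; apply/negP.
    by apply: (notle v x0) => //; apply: sep_in1 Sv x0v.
  by apply: (notle (flip v) y0); rewrite ?separator_flip //; apply: sep_in2 Sv y0v.
have nestv s : s \in N -> nested s v.
  have [_ _ cov] := spl => sN.
  have h u : (exists2 t, t \in sigma & sle u t) -> nested u v.
    move=> [t ts ut]; apply/or4P; case: (nst t ts) => tv.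
      by constructor 1; apply: sle_trans ut tv.
    by constructor 2; apply: sle_trans ut tv.
  have [t ts /orP[sle1|sle1]] := cov s sN; first by apply: h; exists t.
  by rewrite -nested_flip; apply: h; exists t.
case: (maxN) => _; apply; exists (v |: (flip v |: N)); split; last first.
  apply/properP; split; first by apply/subsetP=> s sN; rewrite !inE sN !orbT.
  by exists v; rewrite ?inE ?eqxx.
have vvnest : nested v v by rewrite /nested /sle !subxx.
have in3 s : s \in v |: (flip v |: N) -> [\/ s = v, s = flip v | s \in N].
  by rewrite !inE => /or3P[/eqP|/eqP|]; [constructor 1|constructor 2|constructor 3].
split.
- move=> s /in3[->|->|/sym sN]; rewrite !inE ?flipK ?eqxx ?orbT //.
  by rewrite sN !orbT.
- by move=> s /in3[->|->|/P] //; apply: proper3_flip.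
- have h s : s \in v |: (flip v |: N) -> nested s v.
    by move=> /in3[->|->|/nestv] //; rewrite nested_flip.
  move=> s t sI /in3[->|->|tN]; first exact: h.
    by rewrite -/(nested _ _) nestedC nested_flip nestedC; apply: h.
  rewrite -/(nested _ _); case: (in3 s sI) => [->|->|sN]; last exact: (chop_nested chopN sN tN).
    by rewrite nestedC; apply: nestv.
  by rewrite nested_flip nestedC; apply: nestv.
exists (rcons l v); split.
- move=> s /in3[->|->|/lN]; rewrite !mem_rcons !inE ?flipK ?eqxx ?orbT //.
  by case/orP=> ->; rewrite !orbT.
- by move=> s; rewrite mem_rcons !inE => /orP[->//|/Nl->]; rewrite !orbT.
move=> i; rewrite size_rcons ltnS leq_eqVlt => /orP[/eqP->|il]; last first.
  rewrite nth_rcons il; case: (cl i il) => [h|[j [ji c2]]]; [by left|right].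
  by exists j; rewrite nth_rcons (ltn_trans ji il).
rewrite nth_rcons ltnn eqxx.
(* Either [v] shares two separator vertices with a member, which occurs earlier in the enumeration,
   or its thickness does not come from the cliques of the torso. In the latter case [v] is thick in
   the graph itself, and it is claw-free because the tangle makes the other side thick too. *)
have [[s [x [y [ss xy xI yI]]]]|ns] := classic (exists s (x y : T),
    [/\ s \in sigma, x != y, x \in separator v :&: separator s & y \in separator v :&: separator s]).
  right; have [sN _] := splitting_or ss.
  have [r rl rE] : exists2 r, r \in l & separator r = separator s.
    by case/orP: (lN s sN) => h; [exists s|exists (flip s); rewrite ?separator_flip].
  exists (index r l); rewrite index_mem rl; split=> //.
  rewrite nth_rcons index_mem rl nth_index // rE.
  apply: leq_trans (subset_leq_card (A := [set x; y]) _); first by rewrite cards2 xy.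
  by apply/subsetP=> z /set2P[]->.
left; split=> //.
have thv : thick e v.
  case: th => [c1|[x [y [xs ys exy]]]].
    left; apply: leq_trans c1 _.
    rewrite -(card_imset _ (val_inj : injective (val : torso_vtx sigma -> T))).
    apply/subset_leq_card/subsetP=> z /imsetP[z' + ->].
    by rewrite -Ev !inE.
  right; exists (val x), (val y).
  have xv : val x \in separator v by move: xs; rewrite -Ev separator_preim inE.
  have yv : val y \in separator v by move: ys; rewrite -Ev separator_preim inE.
  split=> //; case/torsoP: exy => xy [//|[s ss [xs' ys']]].
  by case: ns; exists s, (val x), (val y); split; rewrite ?val_eqE //; apply/setIP.
split; first exact: thick_cycle thv.
apply: (thick_cycle e_sym e_irr G3 (s := flip v)); first exact: proper3_flip.
by left; apply: (tangle_big_side e_sym e_irr Htau Ov).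
Qed.

Lemma splitting_normal : is_normal (@torso_og og sigma).
Proof. by move=> K [_ [s [i [so th _ _ _ _]]]]; apply: splitting_thin so th. Qed.

Lemma splitting_internally_4_connected : internally_4_connected (torso_rel e sigma).
Proof.
have st := splitting_star_star; have sO := splitting_sO.
have tW := torso_oriented W st sO.
split; first exact: (torso_connected W st sO).
  rewrite card_sig; exact: (tangle_bag_gt4 e_sym e_irr G3 Htau Hnc st sO).
have thin (s : osep (torso_vtx sigma)) : torso_or e O s -> #|s.1 :\: s.2| = 1 /\
    forall x y, x \in separator s -> y \in separator s -> ~~ torso_rel e sigma x y.
  move=> Os; have nth := splitting_thin Os; split.
    apply/eqP; rewrite eqn_leq; apply/andP; split.
      by rewrite leqNgt; apply/negP=> c; apply: nth; left.
    have [x x2] := or_int1 tW Os; apply/card_gt0P; exists x.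
    by rewrite inE x2 (sep_in1 (or_sep tW Os) x2).
  by move=> x y xs ys; apply/negP=> exy; apply: nth; right; exists x, y.
move=> s P; case: (or_total tW P) => /thin[c ind]; split; [exact: ind|by left| |by right].
by move: ind; rewrite separator_flip.
Qed.

End MaxChop.
End Chops.

Theorem mainTheorem13 (T : finType) (e : rel T)
  (e_sym : symmetric e) (e_irr : irreflexive e)
  (G3 : k_connected e 3)
  (tau : {set osep T}) (Htau : tangle e 4 tau) (Hnc : ~ cubic_tangle e tau)
  (N1 N2 : {set osep T}) (HN1 : max_chop3 e N1) (HN2 : max_chop3 e N2)
  (sigma1 sigma2 : {set osep T})
  (Hs1 : splitting_star N1 sigma1) (Hs1t : sigma1 \subset tau)
  (Hs2 : splitting_star N2 sigma2) (Hs2t : sigma2 \subset tau) :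
  [/\ internally_4_connected (torso_rel e sigma1),
      internally_4_connected (torso_rel e sigma2) &
      isomorphic (torso_rel e sigma1) (torso_rel e sigma2)].
Proof.
split.
- exact: (splitting_internally_4_connected e_sym e_irr G3 Htau Hnc HN1 Hs1 Hs1t).
- exact: (splitting_internally_4_connected e_sym e_irr G3 Htau Hnc HN2 Hs2 Hs2t).
have ok := og_okT e_sym e_irr G3 Htau.
have ok0 : og_ok (@torso_og (tangle_og e tau) set0).
  by apply: (torso_oriented ok) => [s t|s]; rewrite inE.
(* [og_iso] carries a map from its second graph to its first, so [N2] is listed first to obtain a
   map from the torso of [sigma1] to that of [sigma2]. *)
have [f [bf fe _]] := normal_form_unique diamond ok0
  (splitting_reaches e_sym e_irr G3 Htau HN2 Hs2 Hs2t)
  (splitting_normal e_sym e_irr G3 Htau HN2 Hs2 Hs2t)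
  (splitting_reaches e_sym e_irr G3 Htau HN1 Hs1 Hs1t)
  (splitting_normal e_sym e_irr G3 Htau HN1 Hs1 Hs1t).
by exists f.
Qed.
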